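(* For a prime $p$, let $G=\operatorname{SL}_2(\mathbb{Z}/p\mathbb{Z})$ and let $\mathscr{C}_p$ be the set of all pairs $(g,h)\in G^2$ such that $g$ and $h$ generate $G$. There is an absolute constant $C>0$ such that $\operatorname{diam}(\Gamma(G,\{g,h\}))\le C\log p$ for all pairs $(g,h)\in\mathscr{C}_p$ outside a subset of $\mathscr{C}_p$ of cardinality $o(|\mathscr{C}_p|)$ as $p\to\infty$, where the rate of convergence implied by $o(\cdot)$ is absolute; that is, $$\lim_{p\to\infty}\frac{\left|\{(g,h)\in\mathscr{C}_p:\operatorname{diam}(\Gamma(G,\{g,h\}))>C\log p\}\right|}{|\mathscr{C}_p|}=0 .$$
   Context: For a finite group $G$ and a set $S$ of generators of $G$, the Cayley graph $\Gamma(G,S)$ is the (undirected) graph with vertex set $G$ and edge set $\{(sg,g): g\in G, s\in S\}$; its diameter $\operatorname{diam}(\Gamma(G,S))$ is the least $\ell$ such that every element of $G$ is a product of at most $\ell$ elements of $S\cup S^{-1}$. *)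

(* Defs.v *)
From HB Require Import structures.
From mathcomp Require Import all_boot all_order all_algebra all_fingroup.
From mathcomp Require Import all_classical all_reals all_analysis.

Set Implicit Arguments.
Unset Strict Implicit.
Unset Printing Implicit Defensive.

Import Order.TTheory GRing.Theory Num.Theory.

Local Open Scope group_scope.

Section Cayley.
Variable gT : finGroupType.
Implicit Types (G : {group gT}) (S : {set gT}) (x y : gT) (w : seq gT) (l : nat).

(* In group scope, S^-1 is the set of inverses of the elements of S. *)
Definition word_covered G S l : Prop :=
  forall x, x \in G ->
    exists w, [/\ (size w <= l)%N, {subset w <= S :|: S^-1}
                & \prod_(s <- w) s = x].

(* The value 0 in the last case is a convention for sets S that do not        *)
(* generate G; it is never taken when <<S>> = G, see cayley_diamP.            *)
Definition cayley_diam G S : nat :=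
  if pselect (exists l, `[< word_covered G S l >]) is left exl
  then ex_minn exl else 0%N.

Definition cayley_graph S : rel gT :=
  fun x y => [exists s in S, (x == s * y) || (y == s * x)].

Lemma word_covered_gen G S : <<S>> = G -> exists l, word_covered G S l.
Proof.
move=> genS.
have H x : exists w, x \in G ->
    {subset w <= S :|: S^-1} /\ \prod_(s <- w) s = x.
  have [|] := boolP (x \in G); last by exists [::].
  rewrite -genS => /gen_prodgP[n [c cS ->]].
  exists [seq c i | i <- index_enum 'I_n] => _; split.
    by move=> _ /mapP[i _ ->]; rewrite inE cS.
  by rewrite big_map.
have [f fP] := choice H.
exists (\max_(x in G) size (f x)) => x xG; exists (f x).
have [fS fx] := fP x xG; split=> //.
by rewrite (bigD1 x) //= leq_maxl.
Qed.

Lemma cayley_diamP G S : <<S>> = G ->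
  word_covered G S (cayley_diam G S) /\
  (forall l, word_covered G S l -> (cayley_diam G S <= l)%N).
Proof.
move=> genS; rewrite /cayley_diam; case: pselect => [exl|[]]; last first.
  by have [l Hl] := word_covered_gen genS; exists l; apply/asboolP.
case: ex_minnP => m /asboolP Hm minm; split=> // l Hl.
by apply: minm; apply/asboolP.
Qed.

Lemma cayley_graphE S x y : cayley_graph S x y = (y * x^-1 \in S :|: S^-1).
Proof.
apply/existsP/idP => [[s /andP[sS /orP[]/eqP->]]|].
- by rewrite invMg mulKVg !inE invgK sS orbT.
- by rewrite mulgK inE sS.
rewrite !inE invMg invgK => /orP[] H.
- by exists (y * x^-1); rewrite H mulgKV eqxx orbT.
- by exists (x * y^-1); rewrite H mulgKV eqxx.
Qed.

Lemma cayley_walk S x y l :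
  (exists w, [/\ (size w <= l)%N, path (cayley_graph S) x w & last x w = y]) <->
  (exists w, [/\ (size w <= l)%N, {subset w <= S :|: S^-1}
               & \prod_(s <- w) s = y * x^-1]).
Proof.
split=> [[w [wl]]|[w [wl]]].
  suff H : path (cayley_graph S) x w -> exists v,
      [/\ size v = size w, {subset v <= S :|: S^-1}
        & \prod_(s <- v) s = last x w * x^-1].
    by move=> /H[v [sv vS pv]] <-; exists v; rewrite sv.
  elim: w x {wl} => [|z w IHw] x /=.
    by move=> _; exists [::]; split=> //; rewrite big_nil mulgV.
  rewrite cayley_graphE => /andP[zx /IHw[v [sv vS pv]]].
  exists (rcons v (z * x^-1)); split; first by rewrite size_rcons sv.
    by move=> t; rewrite mem_rcons in_cons => /predU1P[-> //|/vS].
  by rewrite -cats1 big_cat big_seq1 /= pv mulgA mulgKV.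
move=> wS wy; suff H : {subset w <= S :|: S^-1} -> exists v,
    [/\ size v = size w, path (cayley_graph S) x v
      & last x v = \prod_(s <- w) s * x].
  by have [v [sv pv lv]] := H wS; exists v; rewrite sv pv lv wy mulgKV.
elim/last_ind: w x y {wl wS wy} => [|w s IHw] x y wS.
  by exists [::]; rewrite big_nil mul1g.
have [|v [sv pv lv]] := IHw (s * x) y.
  by move=> t tw; apply: wS; rewrite mem_rcons in_cons tw orbT.
exists (s * x :: v); split; first by rewrite size_rcons /= sv.
  by rewrite /= cayley_graphE mulgK wS ?mem_rcons ?mem_head.
by rewrite /= lv -cats1 big_cat big_seq1 /= mulgA.
Qed.

Lemma cayley_diam_graphP G S l : <<S>> = G ->
  (cayley_diam G S <= l)%N <->
  (forall x y, x \in G -> y \in G ->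
    exists w, [/\ (size w <= l)%N, path (cayley_graph S) x w & last x w = y]).
Proof.
move=> genS; have [cov mincov] := cayley_diamP genS; split=> [le_l x y xG yG|H].
  apply/cayley_walk.
  have [w [wl wS wp]] := cov (y * x^-1) (groupM yG (groupVr xG)).
  by exists w; split=> //; apply: leq_trans le_l.
apply: mincov => x xG; have /cayley_walk := H 1 x (group1 G) xG.
by rewrite invg1 mulg1.
Qed.

End Cayley.

(* For prime p, the ring 'F_p is Z/pZ.  The general linear group is the       *)
(* library's ambient finite group of invertible 2 x 2 matrices.               *)
Definition SL2_set (p : nat) : {set {'GL_2(p)}} :=
  [set u : {'GL_2(p)} | (\det (GLval u) == 1)%R].

Lemma SL2_group_set (p : nat) : group_set (SL2_set p).
Proof.
apply/group_setP; split=> [|u v]; rewrite !inE ?GL_1E ?det1 //.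
by move=> /eqP du /eqP dv; rewrite GL_MxE det_mulmx du dv mulr1.
Qed.

Definition SL2 (p : nat) : {group {'GL_2(p)}} := Group (SL2_group_set p).

Definition gen_pairs (p : nat) : {set {'GL_2(p)} * {'GL_2(p)}} :=
  [set gh | [&& gh.1 \in SL2 p, gh.2 \in SL2 p
             & <<[set gh.1; gh.2]>> == SL2 p :> {set {'GL_2(p)}}]].

Definition large_diam_pairs (R : realType) (C : R) (p : nat) :
    {set {'GL_2(p)} * {'GL_2(p)}} :=
  [set gh in gen_pairs p |
    (C * ln (p%:R : R) < (cayley_diam (SL2 p) [set gh.1; gh.2])%:R)%R].

(* Main.v *)
Require Import Defs.
From mathcomp Require Import all_boot all_order all_algebra all_fingroup.
From mathcomp Require Import ring zify.

Set Implicit Arguments.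
Unset Strict Implicit.
Unset Printing Implicit Defensive.

(* Two distinct positive words of length n <= c log p take different values at a pair
   of elementary matrices; as their entries are polynomials of degree <= n along
   unipotent one-parameter families, they take different values at most pairs (g, h).
   So for all but p^(5+eps) pairs the balls in the Cayley graph contain p^c elements
   already at radius O(log p).

   For a ball A with |A^6| <= K|A|, the traces tr x, tr xg, tr xh determine x up to
   two choices, so A^2 meets at least (|A|/2)^(1/3) conjugacy classes, one of which is
   sparse in A^4; its elements have large centralizers in A^2. Helfgott's pivot argument
   then shows that either K is large or every conjugate torus meets A^2 in about
   |A|^(1/3) elements, and since there are about p^2 such tori, |A| is almost p^3. So
   after boundedly many expansions the ball has p^(3-eps) elements, and a sum-product
   estimate on the upper unipotents gives SL_2(F_p) as a bounded power of it.

   To compare with the number of generating pairs it is enough to produce p^(5+2 eps)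
   of these: g of order >= I and h = g^i v with i < I and v unipotent. *)

(** Almost all pairs generate, but the usual proof goes through the classification of subgroups. A
    lower bound of order [p^(5+5/11)] from an explicit family suffices, because a coincidence of
    words is a polynomial condition and costs a full factor [p]. To see that this condition is not
    an identity, one pair is needed at which all words differ: over the integers the two elementary
    matrices generate a free monoid, and for [2^n < p] reduction modulo [p] loses nothing. The
    length [n = 11 k], with [2^(88 k) <= p], is a compromise. As [2^n] is about [p^(1/8)], the [4^n]
    conditions leave about [p^(5+1/4) log p] bad pairs; yet [K = 2^k] is a fixed power of [p] up to
    constants, so boundedly many expansions by [K] exhaust the group. One geometric fact recurs: the
    centralizer of a regular element of [SL_2] is a conic in the plane spanned by 1 and that
    element, and a trace condition is a line, so they meet in at most two points. It bounds
    centralizers, products of classes with tori, conjugates in a torus, and the fibres in the count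
    of generating pairs. *)

Import Order.TTheory GRing.Theory Num.Theory.

(** * Entries of two by two matrices *)

(* A sealed name for the group: inference never unfolds its group structure. *)
Definition gl2 (F : finFieldType) : finGroupType := {'GL_2[F]}.

Section Mat2.
Variable F : finFieldType.
Local Notation gT := (gl2 F).
Implicit Types (x y : gT) (s t a b c d : F).
Local Open Scope ring_scope.

Definition ea x : F := GLval (x : {'GL_2[F]}) ord0 ord0.
Definition eb x : F := GLval (x : {'GL_2[F]}) ord0 ord_max.
Definition ec x : F := GLval (x : {'GL_2[F]}) ord_max ord0.
Definition ed x : F := GLval (x : {'GL_2[F]}) ord_max ord_max.
Definition tr x := ea x + ed x.

Lemma gl2P x y :
  ea x = ea y -> eb x = eb y -> ec x = ec y -> ed x = ed y -> x = y.
Proof.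
rewrite /ea /eb /ec /ed => H1 H2 H3 H4; apply/val_inj/matrixP => i j.
have /orP[/eqP->|/eqP->] : (i == ord0) || (i == ord_max) by case: i => [] [|[]].
all: have /orP[/eqP->|/eqP->] : (j == ord0) || (j == ord_max) by case: j => [] [|[]].
all: by [].
Qed.

Let mulE x y (i j : 'I_2) : GLval ((x * y)%g : {'GL_2[F]}) i j =
  GLval (x : {'GL_2[F]}) i ord0 * GLval (y : {'GL_2[F]}) ord0 j
  + GLval (x : {'GL_2[F]}) i ord_max * GLval (y : {'GL_2[F]}) ord_max j.
Proof.
rewrite GL_MxE mxE !big_ord_recl big_ord0 addr0.
by congr (_ * _ + GLval (x : {'GL_2[F]}) i _ * GLval (y : {'GL_2[F]}) _ j); apply/val_inj.
Qed.

Lemma eaM x y : ea (x * y)%g = ea x * ea y + eb x * ec y. Proof. exact: mulE. Qed.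
Lemma ebM x y : eb (x * y)%g = ea x * eb y + eb x * ed y. Proof. exact: mulE. Qed.
Lemma ecM x y : ec (x * y)%g = ec x * ea y + ed x * ec y. Proof. exact: mulE. Qed.
Lemma edM x y : ed (x * y)%g = ec x * eb y + ed x * ed y. Proof. exact: mulE. Qed.
Lemma ea1 : ea 1%g = 1. Proof. by rewrite /ea GL_1E mxE eqxx. Qed.
Lemma eb1 : eb 1%g = 0. Proof. by rewrite /eb GL_1E mxE. Qed.
Lemma ec1 : ec 1%g = 0. Proof. by rewrite /ec GL_1E mxE. Qed.
Lemma ed1 : ed 1%g = 1. Proof. by rewrite /ed GL_1E mxE eqxx. Qed.

Definition entM := (eaM, ebM, ecM, edM, (ea1, eb1, ec1, ed1)).

Lemma det_entries x : \det (GLval (x : {'GL_2[F]})) = ea x * ed x - eb x * ec x.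
Proof.
rewrite (expand_det_row _ ord0) !big_ord_recl big_ord0 /cofactor !det_mx11 /=.
rewrite !mxE /= expr0 expr1 mul1r addr0 mulN1r mulrN.
by congr (GLval (x : {'GL_2[F]}) _ _ * GLval (x : {'GL_2[F]}) _ _
          - GLval (x : {'GL_2[F]}) _ _ * GLval (x : {'GL_2[F]}) _ _);
   apply/val_inj.
Qed.

Definition SL : {set gT} := [set x | \det (GLval (x : {'GL_2[F]})) == 1].

Lemma SLP x : reflect (ea x * ed x - eb x * ec x = 1) (x \in SL).
Proof. by rewrite inE det_entries; apply: eqP. Qed.

Lemma SL_group_set : group_set SL.
Proof.
apply/group_setP; split=> [|x y]; first by apply/SLP; rewrite !entM; ring.
move=> /SLP hx /SLP hy; apply/SLP; rewrite !entM -[RHS]mulr1 -{1}hx -hy.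
by ring.
Qed.
Canonical SL_group := Group SL_group_set.

Lemma SLV x : x \in SL -> [/\ ea x^-1%g = ed x, eb x^-1%g = - eb x,
  ec x^-1%g = - ec x & ed x^-1%g = ea x].
Proof.
move=> xS; have /SLP hy := groupVr xS; move/SLP: xS => hx.
have := congr1 ea (mulVg x); have := congr1 eb (mulVg x).
have := congr1 ec (mulVg x); have := congr1 ed (mulVg x).
rewrite !entM; set a := ea x; set b := eb x; set c := ec x; set d := ed x.
set a' := ea _; set b' := eb _; set c' := ec _; set d' := ed _.
rewrite -/a -/b -/c -/d in hx * => H4 H3 H2 H1; split.
- have -> : a' = a' * (a * d - b * c) by rewrite hx mulr1.
  rewrite (_ : a' * _ = d * (a' * a + b' * c) - c * (a' * b + b' * d)); last by ring.
  by rewrite H1 H2; ring.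
- have -> : b' = b' * (a * d - b * c) by rewrite hx mulr1.
  rewrite (_ : b' * _ = a * (a' * b + b' * d) - b * (a' * a + b' * c)); last by ring.
  by rewrite H1 H2; ring.
- have -> : c' = c' * (a * d - b * c) by rewrite hx mulr1.
  rewrite (_ : c' * _ = d * (c' * a + d' * c) - c * (c' * b + d' * d)); last by ring.
  by rewrite H3 H4; ring.
- have -> : d' = d' * (a * d - b * c) by rewrite hx mulr1.
  rewrite (_ : d' * _ = a * (c' * b + d' * d) - b * (c' * a + d' * c)); last by ring.
  by rewrite H3 H4; ring.
Qed.

(* A singular matrix is sent to the junk value 1. *)
Definition mkSL a b c d : gT :=
  insubd (1%g : {'GL_2[F]}) (\matrix_(i < 2, j < 2)
    if (i : nat) == 0%N then if (j : nat) == 0%N then a else b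
    else if (j : nat) == 0%N then c else d).

Lemma mkSLE a b c d : a * d - b * c = 1 ->
  [/\ ea (mkSL a b c d) = a, eb (mkSL a b c d) = b, ec (mkSL a b c d) = c
    & ed (mkSL a b c d) = d].
Proof.
move=> H; set M := \matrix_(i < 2, j < 2) 
    (if (i : nat) == 0%N then if (j : nat) == 0%N then a else b
    else if (j : nat) == 0%N then c else d).
have E : GLval (mkSL a b c d : {'GL_2[F]}) = M.
  rewrite /mkSL -/M /insubd insubT //= unitmxE.
  rewrite (expand_det_row _ ord0) !big_ord_recl big_ord0 /cofactor !det_mx11 /=.
  by rewrite !mxE /= expr0 expr1 mul1r addr0 mulN1r mulrN H unitr1.
by split; rewrite /ea /eb /ec /ed E mxE.
Qed.

Lemma mkSL_SL a b c d : a * d - b * c = 1 -> mkSL a b c d \in SL.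
Proof. by move=> H; apply/SLP; have [-> -> -> ->] := mkSLE H. Qed.

Definition upper t := mkSL 1 t 0 1.
Definition lower t := mkSL 1 0 t 1.

Let upper_det t : 1 * 1 - t * 0 = 1 :> F. Proof. by ring. Qed.
Let lower_det t : 1 * 1 - 0 * t = 1 :> F. Proof. by ring. Qed.
Lemma ea_upper t : ea (upper t) = 1. Proof. by have [] := mkSLE (upper_det t). Qed.
Lemma eb_upper t : eb (upper t) = t. Proof. by have [] := mkSLE (upper_det t). Qed.
Lemma ec_upper t : ec (upper t) = 0. Proof. by have [] := mkSLE (upper_det t). Qed.
Lemma ed_upper t : ed (upper t) = 1. Proof. by have [] := mkSLE (upper_det t). Qed.
Lemma ea_lower t : ea (lower t) = 1. Proof. by have [] := mkSLE (lower_det t). Qed.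
Lemma eb_lower t : eb (lower t) = 0. Proof. by have [] := mkSLE (lower_det t). Qed.
Lemma ec_lower t : ec (lower t) = t. Proof. by have [] := mkSLE (lower_det t). Qed.
Lemma ed_lower t : ed (lower t) = 1. Proof. by have [] := mkSLE (lower_det t). Qed.
Definition entUL := ((ea_upper, eb_upper, ec_upper, ed_upper),
  (ea_lower, eb_lower, ec_lower, ed_lower), entM).

Lemma upper_SL t : upper t \in SL. Proof. exact/mkSL_SL/upper_det. Qed.
Lemma lower_SL t : lower t \in SL. Proof. exact/mkSL_SL/lower_det. Qed.

Lemma upperD s t : upper (s + t) = (upper s * upper t)%g.
Proof. by apply: gl2P; rewrite !entUL; ring. Qed.
Lemma lowerD s t : lower (s + t) = (lower s * lower t)%g.
Proof. by apply: gl2P; rewrite !entUL; ring. Qed.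
Lemma upper0 : upper 0 = 1%g.
Proof. by apply: gl2P; rewrite !entUL. Qed.
Lemma lower0 : lower 0 = 1%g.
Proof. by apply: gl2P; rewrite !entUL. Qed.
Lemma upperN t : upper (- t) = (upper t)^-1%g.
Proof. by apply: (mulIg (upper t)); rewrite -upperD addNr upper0 mulVg. Qed.
Lemma lowerN t : lower (- t) = (lower t)^-1%g.
Proof. by apply: (mulIg (lower t)); rewrite -lowerD addNr lower0 mulVg. Qed.

Lemma SL_bruhat x : x \in SL -> ec x != 0 ->
  x = (upper ((ea x - 1) / ec x)%R * lower (ec x) * upper ((ed x - 1) / ec x)%R)%g.
Proof.
move=> /SLP hx c0; apply: gl2P; rewrite !entUL; try by field.
apply: (mulfI c0); rewrite -[ec x * eb x]opprK -[X in - X](addrK (ea x * ed x)).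
rewrite (_ : - _ + _ = ea x * ed x - eb x * ec x); last by ring.
by rewrite hx; field.
Qed.

(** If [ec x = 0] then [ed x] is nonzero, and right multiplication by [lower 1] moves [x] into the
    big Bruhat cell; the fourth factor undoes this. *)
Lemma SL_upper_lower x : x \in SL ->
  exists s1 s2 s3 s4, x = (upper s1 * lower s2 * upper s3 * lower s4)%g.
Proof.
move=> xS; have [c0|c0] := eqVneq (ec x) 0; last first.
  do 3 eexists; exists 0; rewrite lower0 mulg1; exact: SL_bruhat.
have d0 : ed x != 0.
  apply/eqP => d0; move/SLP: xS => /eqP.
  by rewrite c0 d0 !mulr0 subr0 eq_sym oner_eq0.
have y_c : ec (x * lower 1%R)%g != 0 by rewrite !entUL c0 mul0r add0r mulr1.
have yS : (x * lower 1%R)%g \in SL by rewrite groupM ?lower_SL.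
do 3 eexists; exists (- 1).
rewrite lowerN; apply: (mulIg (lower 1)); rewrite mulgKV; exact: SL_bruhat.
Qed.

Lemma tr1 : tr 1%g = 2. Proof. by rewrite /tr !entM; ring. Qed.

Lemma trM_comm x y : tr (x * y)%g = tr (y * x)%g.
Proof. by rewrite /tr !entM; ring. Qed.

Lemma trJ x y : tr (x ^ y)%g = tr x.
Proof. by rewrite conjgE mulgA trM_comm mulgA mulgV mul1g. Qed.

End Mat2.
Arguments upper {F} t%_R.
Arguments lower {F} t%_R.
Opaque gl2.

(** * Maximal tori *)

Section LinearCombination.
Variable R : comPzRingType.
Local Open Scope ring_scope.
Implicit Types A B L S c : R.

(** Certificates: the coefficients exhibit the goal as a combination of known equations, and the
    remaining identity is left to [ring]. *)
Lemma lincomb1 c1 A B L1 S1 : L1 = S1 -> A - B = c1 * (L1 - S1) -> A = B.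
Proof. by move=> -> H; apply: subr0_eq; rewrite H subrr mulr0. Qed.

Lemma lincomb2 c1 c2 A B L1 S1 L2 S2 : L1 = S1 -> L2 = S2 ->
  A - B = c1 * (L1 - S1) + c2 * (L2 - S2) -> A = B.
Proof. by move=> -> -> H; apply: subr0_eq; rewrite H !subrr !mulr0 addr0. Qed.

Lemma lincomb3 c1 c2 c3 A B L1 S1 L2 S2 L3 S3 : L1 = S1 -> L2 = S2 -> L3 = S3 ->
  A - B = c1 * (L1 - S1) + c2 * (L2 - S2) + c3 * (L3 - S3) -> A = B.
Proof.
by move=> -> -> -> H; apply: subr0_eq; rewrite H !subrr !mulr0 !addr0.
Qed.

End LinearCombination.
Arguments lincomb1 {R} c1%_R {A B L1 S1}.
Arguments lincomb2 {R} (c1 c2)%_R {A B L1 S1 L2 S2}.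
Arguments lincomb3 {R} (c1 c2 c3)%_R {A B L1 S1 L2 S2 L3 S3}.

Section Counting.
Variables T U : finType.

Lemma card_le_fiber (f : T -> U) (A : {set T}) k :
  (forall x, x \in A -> #|[set y in A | f y == f x]| <= k) ->
  #|A| <= k * #|f @: A|.
Proof.
move=> Hk; rewrite -sum1_card (partition_big_imset f) /= mulnC -sum_nat_const.
apply: leq_sum => _ /imsetP[x xA ->]; rewrite sum1dep_card; apply: leq_trans (Hk x xA).
by apply: subset_leq_card; apply/subsetP=> y; rewrite !inE.
Qed.

Lemma card_le2 (A : {set T}) :
  (forall x y z, x \in A -> y \in A -> z \in A -> y != x -> z != x -> z = y) ->
  #|A| <= 2.
Proof.
move=> H; have [->|[x xA]] := set_0Vmem A; first by rewrite cards0.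
have [AD0|[y]] := set_0Vmem (A :\ x).
  by rewrite (cardsD1 x) xA AD0 cards0.
rewrite !inE => /andP[yx yA]; apply: (@leq_trans #|[set x; y]|).
  apply/subset_leq_card/subsetP => z zA; rewrite !inE.
  by case: eqP => //= /eqP zx; rewrite (H x y z).
by rewrite cards2 ltnS leq_b1.
Qed.

End Counting.

Section Tori.
Variable F : finFieldType.
Local Notation gT := (gl2 F).
Implicit Types (x y a u g h : gT) (s t : F).
Local Open Scope ring_scope.

(** For [a] in [SL F] the discriminant of the characteristic polynomial is [tr a ^+ 2 - 4]; regular
    means two distinct eigenvalues over an algebraic closure. *)
Definition regular a := tr a ^+ 2 != 4.

Lemma regular_nonscalar a : a \in SL F -> regular a ->
  ~~ [&& ea a == ed a, eb a == 0 & ec a == 0].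
Proof.
move=> /SLP da; apply: contra => /and3P[/eqP H1 /eqP H2 /eqP H3].
apply/eqP; rewrite /tr; move: da; rewrite H1 H2 H3 mul0r subr0 => da.
by apply: (lincomb1 4 da); ring.
Qed.

(** Commutation says that the vectors (diagonal difference, upper right, lower left) of [a] and [y]
    are proportional. The one of [a] is nonzero, so [y] is a combination of 1 and [a]; the cases
    pick a nonzero coordinate to divide by. *)
Lemma cent_regular a y : a \in SL F -> regular a -> commute a y ->
  exists l m, [/\ ea y = l + m * ea a, eb y = m * eb a, ec y = m * ec a
                & ed y = l + m * ed a].
Proof.
move=> aS ra cay; have := regular_nonscalar aS ra.
have := congr1 (@ea F) cay; have := congr1 (@eb F) cay; have := congr1 (@ec F) cay.
rewrite !entM => Hc Hb Ha.
have E1 : eb a * ec y = ec a * eb y by apply: (lincomb1 1 Ha); ring.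
have E2 : (ea a - ed a) * eb y = (ea y - ed y) * eb a.
  by apply: (lincomb1 1 Hb); ring.
have E3 : (ea a - ed a) * ec y = (ea y - ed y) * ec a.
  by apply: (lincomb1 (-1) Hc); ring.
rewrite -subr_eq0; have [a0|a0 _] := eqVneq (ea a - ed a) 0; last first.
  exists (ea y - (ea y - ed y) / (ea a - ed a) * ea a), ((ea y - ed y) / (ea a - ed a)).
  split; first by ring.
  - by apply: (mulfI a0); rewrite E2; field.
  - by apply: (mulfI a0); rewrite E3; field.
  - by field.
have Had : ea a = ed a by apply: subr0_eq.
rewrite a0 !mul0r in E2 E3 => /=.
rewrite negb_and => bc0; have Hy : ea y = ed y.
  by apply/subr0_eq/eqP; case/orP: bc0 => b0; [move/esym/eqP: E2|move/esym/eqP: E3];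
  rewrite mulf_eq0 (negPf b0) orbF.
have [b0|b0] := eqVneq (eb a) 0.
  have c0 : ec a != 0 by move: bc0; rewrite b0 eqxx.
  exists (ea y - ec y / ec a * ea a), (ec y / ec a); split; rewrite ?Hy ?Had; try by field.
  by apply: (mulfI c0); rewrite -E1 b0; ring.
exists (ea y - eb y / eb a * ea a), (eb y / eb a); split; rewrite ?Hy ?Had; try by field.
by apply: (mulfI b0); rewrite E1; field.
Qed.

Lemma cent_regular_comm a x y : a \in SL F -> regular a ->
  commute a x -> commute a y -> commute x y.
Proof.
move=> aS ra /(cent_regular aS ra)[l [m [H1 H2 H3 H4]]].
move=> /(cent_regular aS ra)[l' [m' [H1' H2' H3' H4']]].
by apply: gl2P; rewrite !entM ?H1 ?H2 ?H3 ?H4 ?H1' ?H2' ?H3' ?H4'; ring.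
Qed.

(** Writing [y = l + m a], the discriminant of [y] is [m ^+ 2] times that of [a]. Trace 2 makes it
    vanish, so [m = 0], and then [(l - 1) ^+ 2 = 0]. *)
Lemma cent_tr2 a y : a \in SL F -> y \in SL F -> regular a -> commute a y ->
  tr y = 2 -> y = 1%g.
Proof.
move=> aS /SLP dy ra /(cent_regular aS ra)[l [m [H1 H2 H3 H4]]] ty.
have m0 : m = 0.
  have : m ^+ 2 * (tr a ^+ 2 - 4) = 0.
    move/SLP: aS => da; move: dy ty; rewrite /tr H1 H2 H3 H4 => dy ty.
    apply: (lincomb3 (4 * m ^+ 2) (-4) (2 + (l + m * ea a + (l + m * ed a))) da dy ty).
    by ring.
  by move/eqP; rewrite mulf_eq0 subr_eq0 (negPf ra) orbF expf_eq0 => /eqP.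
move: dy ty; rewrite /tr H1 H2 H3 H4 m0 !mul0r !addr0 subr0 => dy ty.
have /eqP : (l - 1) ^+ 2 = 0 by apply: (lincomb2 1 (-1) dy ty); ring.
rewrite expf_eq0 subr_eq0 => /eqP l1.
by apply: gl2P; rewrite !entM ?H1 ?H2 ?H3 ?H4 ?l1 m0; ring.
Qed.

(* C(a) meets the determinant-one condition in a conic, which contains no line. *)
Lemma card_cent_tr a u t (Y : {set gT}) : a \in SL F -> regular a ->
  ~ (tr u = 0 /\ tr (u * a)%g = 0) ->
  (forall y, y \in Y -> [/\ y \in SL F, commute a y & tr (u * y)%g = t]) ->
  (#|Y| <= 2)%N.
Proof.
move=> aS ra Hu HY; apply: card_le2 => x y z xY yY zY yx zx.
have [xS cx tx] := HY x xY; have [yS cy ty] := HY y yY.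
have [zS cz tz] := HY z zY.
have [l [m [X1 X2 X3 X4]]] := cent_regular aS ra cx.
have [l1 [m1 [Y1 Y2 Y3 Y4]]] := cent_regular aS ra cy.
have [l2 [m2 [Z1 Z2 Z3 Z4]]] := cent_regular aS ra cz.
(* The left side is [tr (y * x^-1) - 2], with the inverse written out as the adjugate. *)
have D0 : ea y * ed x - eb y * ec x - ec y * eb x + ed y * ea x - 2 != 0.
  apply: contra yx => /eqP/subr0_eq H.
  rewrite eq_mulgV1; apply/eqP; apply: (cent_tr2 aS) => //.
  - by rewrite groupM ?groupV.
  - by apply: commuteM => //; apply: commuteV.
  - by rewrite -H /tr !entM; have [-> -> -> ->] := SLV xS; ring.
have {}tx : l * tr u + m * tr (u * a)%g = t.
  by rewrite -tx /tr !entM X1 X2 X3 X4; ring.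
have {}ty : l1 * tr u + m1 * tr (u * a)%g = t.
  by rewrite -ty /tr !entM Y1 Y2 Y3 Y4; ring.
have {}tz : l2 * tr u + m2 * tr (u * a)%g = t.
  by rewrite -tz /tr !entM Z1 Z2 Z3 Z4; ring.
(* Both differences solve the same homogeneous linear equation, whose coefficients are not both
   zero. *)
have par : (l2 - l) * (m1 - m) = (l1 - l) * (m2 - m).
  have [u0|u0] := eqVneq (tr u) 0.
    have ua0 : tr (u * a)%g != 0 by apply/eqP => ua0; apply: Hu.
    apply: (mulfI ua0).
    by apply: (lincomb3 (l1 - l2) (l2 - l) (l - l1) tx ty tz); rewrite u0; ring.
  apply: (mulfI u0).
  by apply: (lincomb3 (m2 - m1) (m - m2) (m1 - m) tx ty tz); ring.
have [s [Hl Hm]] : exists s, l2 - l = s * (l1 - l) /\ m2 - m = s * (m1 - m).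
  have [l10|l10] := eqVneq (l1 - l) 0; last first.
    exists ((l2 - l) / (l1 - l)); split; first by field.
    by apply: (mulfI l10); rewrite -par; field.
  have m10 : m1 - m != 0.
    apply: contra yx; rewrite subr_eq0 => /eqP mm; apply/eqP.
    by apply: gl2P; rewrite ?Y1 ?Y2 ?Y3 ?Y4 ?X1 ?X2 ?X3 ?X4 mm ?(subr0_eq l10).
  exists ((m2 - m) / (m1 - m)); split; last by field.
  by apply: (mulIf m10); rewrite par l10; field.
have el2 : l2 = l + s * (l1 - l) by rewrite -Hl; ring.
have em2 : m2 = m + s * (m1 - m) by rewrite -Hm; ring.
move/SLP: xS => dx; move/SLP: yS => dy; move/SLP: zS => dz.
(* On the line through [x] and [y], determinant minus one is quadratic in [s] with roots 0 and 1 and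
   leading coefficient the nonzero quantity of [D0], up to sign. *)
have : s * (s - 1) = 0.
  apply: (mulfI D0); rewrite mulr0.
  move: dx dy dz.
  rewrite X1 X2 X3 X4 Y1 Y2 Y3 Y4 Z1 Z2 Z3 Z4 el2 em2 => dx dy dz.
  by apply: (lincomb3 ((s - 1) ^+ 2) (s ^+ 2) (- 1) dx dy dz); ring.
move/eqP; rewrite mulf_eq0 subr_eq0 => /orP[]/eqP s0.
  case/negP: zx; apply/eqP; apply: gl2P;
  by rewrite ?Z1 ?Z2 ?Z3 ?Z4 ?X1 ?X2 ?X3 ?X4 ?el2 em2 s0; ring.
by apply: gl2P; rewrite ?Z1 ?Z2 ?Z3 ?Z4 ?Y1 ?Y2 ?Y3 ?Y4 ?el2 em2 s0; ring.
Qed.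

(** If [tr u] and [tr (u * a)] both vanished, [tr (u * y)] would vanish on the whole span of 1 and
    [a]; a nonzero [t] rules this out. *)
Lemma card_cent_tr_neq0 a u t (Y : {set gT}) : a \in SL F -> regular a -> t != 0 ->
  (forall y, y \in Y -> [/\ y \in SL F, commute a y & tr (u * y)%g = t]) ->
  (#|Y| <= 2)%N.
Proof.
move=> aS ra t0 HY; have [->|[y /HY[yS cy ty]]] := set_0Vmem Y; first by rewrite cards0.
apply: (card_cent_tr aS ra _ HY) => -[H1 H2]; move/eqP: t0; apply; rewrite -ty.
have [l [m [Y1 Y2 Y3 Y4]]] := cent_regular aS ra cy.
transitivity (l * tr u + m * tr (u * a)%g).
  by rewrite /tr !(entM F, Y1, Y2, Y3, Y4); ring.
by rewrite H1 H2 !mulr0 addr0.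
Qed.

End Tori.

(** * Balls and orbit counting *)

Section Ball.
Variable gT : finGroupType.
Implicit Types (S A B E : {set gT}) (x y b : gT) (r s : nat).
Local Open Scope group_scope.

Definition word_ball S r : {set gT} := (1 |: (S :|: S^-1)) ^+ r.

Lemma ballD S r s : word_ball S (r + s) = word_ball S r * word_ball S s.
Proof. exact: expgD. Qed.

Lemma ball_mul S r s x y : x \in word_ball S r -> y \in word_ball S s ->
  x * y \in word_ball S (r + s).
Proof. by move=> xB yB; rewrite ballD mem_mulg. Qed.

Lemma mem_ball1 S r : 1 \in word_ball S r.
Proof.
elim: r => [|r IHr]; first by rewrite /word_ball expg0 set11.
rewrite /word_ball expgSr; apply/mulsgP; exists 1 1; rewrite ?mulg1 //.
by rewrite !inE eqxx.
Qed.

Lemma sub_ball S r s : (r <= s)%N -> word_ball S r \subset word_ball S s.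
Proof.
move=> /subnKC <-; apply/subsetP => x xB.
by rewrite -(mulg1 x) ball_mul ?mem_ball1.
Qed.

Lemma ballV S r x : x \in word_ball S r -> x^-1 \in word_ball S r.
Proof.
suff H : (word_ball S r)^-1 = word_ball S r by rewrite -{2}H memV_invg.
rewrite /word_ball; elim: r => [|r IHr]; first by rewrite expg0 invg1.
rewrite {1}expgS invMg IHr expgSr; congr (_ * _).
by apply/setP => y; rewrite !inE invgK eq_invg1 orbC [in RHS]orbC [(y \in S) || _]orbC.
Qed.

Lemma gen_sub_ball S r x : x \in S -> (0 < r)%N -> x \in word_ball S r.
Proof.
move=> xS r0; apply: (subsetP (sub_ball S r0)).
by rewrite /word_ball expg1 !inE xS orbT.
Qed.

Lemma ball_sub S (G : {group gT}) r : S \subset G -> word_ball S r \subset G.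
Proof.
move=> SG; elim: r => [|r IHr]; first by rewrite /word_ball expg0 sub1G.
rewrite /word_ball expgS mul_subG // subUset sub1set group1 subUset SG.
by rewrite -(invGid G) invSg.
Qed.

Lemma ball_word S r x : x \in word_ball S r ->
  exists w, [/\ (size w <= r)%N, {subset w <= S :|: S^-1} & \prod_(s <- w) s = x].
Proof.
elim: r x => [|r IHr] x.
  by rewrite /word_ball expg0 => /set1P ->; exists [::]; rewrite big_nil.
rewrite /word_ball expgS => /mulsgP[s y]; rewrite in_setU1 => sS /IHr[w [wr wS wy]] ->.
case/orP: sS => [/eqP->|sS].
  by exists w; rewrite mul1g; split=> //; apply: leqW.
exists (s :: w); split; rewrite ?big_cons ?wy //.
by move=> z; rewrite inE => /orP[/eqP->|/wS].
Qed.

(** Orbit-stabilizer for sets: if [x] and [y] give the same conjugate of [b], then [x^-1 * y]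
    centralizes [b], so a fibre translates into [B :&: 'C[b]]. *)
Lemma card_orbit_le A B b : (forall x y, x \in A -> y \in A -> x^-1 * y \in B) ->
  #|A| <= #|B :&: 'C[b]| * #|[set b ^ x^-1 | x in A]|.
Proof.
move=> AB; apply: card_le_fiber => x xA.
rewrite -(card_imset _ (mulgI x^-1)) subset_leq_card //.
apply/subsetP => _ /imsetP[y /setIdP[yA /eqP e] ->].
rewrite inE AB //=; apply/cent1P/esym/commgP/conjg_fixP.
by rewrite conjgM -e conjgKV.
Qed.

Lemma card_mul_le A E (T : {group gT}) k : E \subset T ->
  (forall x, x \in A -> #|[set y in A | x^-1 * y \in T]| <= k) ->
  #|A| * #|E| <= k * #|A * E|.
Proof.
move=> ET Ak; rewrite -cardsX.
have -> : A * E = [set u.1 * u.2 | u in setX A E].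
  apply/setP => z; apply/mulsgP/imsetP => [[x y xA yE ->]|[[x y]]].
    by exists (x, y); rewrite // inE xA.
  by rewrite inE => /andP[xA yE] ->; exists x y.
apply: card_le_fiber => -[x y] /setXP[/= xA yE].
apply: leq_trans (Ak x xA).
have inj : {in [set u in setX A E | u.1 * u.2 == x * y] &, injective fst}.
  move=> [x1 y1] [x2 y2]; rewrite !inE /= => /andP[_ /eqP e1] /andP[_ /eqP e2] ex.
  by congr (_, _) => //; apply: (mulgI x1); rewrite e1 ex e2.
rewrite -(card_in_imset inj) subset_leq_card //.
apply/subsetP => _ /imsetP[[x1 y1] /setIdP[/setXP[/= x1A y1E] /eqP e] ->] /=.
rewrite inE x1A (_ : x^-1 * x1 = y * y1^-1).
  by rewrite groupM ?groupV ?(subsetP ET).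
by apply: (mulgI x); rewrite mulKVg mulgA -e mulgK.
Qed.

End Ball.

(** * Trace coordinates, and products of a class with a torus *)

Section Traces.
Variable F : finFieldType.
Local Notation gT := (gl2 F).
Implicit Types (x y a u g h : gT) (s t : F).
Local Open Scope ring_scope.

(** The entries of [gh - hg]; this matrix has trace zero, so its last entry is [- comm11 g h]. *)
Definition comm11 g h := eb g * ec h - eb h * ec g.
Definition comm12 g h := eb h * (ea g - ed g) - eb g * (ea h - ed h).
Definition comm21 g h := ec g * (ea h - ed h) - ec h * (ea g - ed g).
(* Minus the determinant of the matrix gh - hg. *)
Definition commdet g h := comm11 g h ^+ 2 + comm12 g h * comm21 g h.

(* Matrices with prescribed traces against 1, g, h form a line of direction gh - hg. *)
Lemma card_trace_coords g h (A B : {set gT}) : commdet g h != 0 ->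
  A \subset SL F -> A \subset B ->
  (forall x, x \in A -> (x * g)%g \in B) -> (forall x, x \in A -> (x * h)%g \in B) ->
  (#|A| <= 2 * #|(@tr F) @: B| ^ 3)%N.
Proof.
move=> k0 AS AB Ag Ah; pose f x := (tr x, tr (x * g)%g, tr (x * h)%g).
have sub_f : f @: A \subset setX (setX ((@tr F) @: B) ((@tr F) @: B)) ((@tr F) @: B).
  apply/subsetP => _ /imsetP[x xA ->]; rewrite !inE /=.
  by rewrite !imset_f ?Ag ?Ah ?(subsetP AB).
have /leq_trans : (#|A| <= 2 * #|f @: A|)%N; last first.
  by apply; rewrite leq_mul2l /= (leq_trans (subset_leq_card sub_f)) // !cardsX expnSr mulnn.
apply: card_le_fiber => x0 _; apply: card_le2 => x y z.
move=> /setIdP[/(subsetP AS)/SLP dx /eqP fx] /setIdP[/(subsetP AS)/SLP dy /eqP fy].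
move=> /setIdP[/(subsetP AS)/SLP dz /eqP fz]; rewrite -{}fx {x0} in fy fz.
have par w : f w = f x -> exists s, [/\ ea w = ea x + s * comm11 g h,
    eb w = eb x + s * comm12 g h, ec w = ec x + s * comm21 g h
    & ed w = ed x - s * comm11 g h].
  rewrite /f /tr !entM => -[T1 T2 T3].
  have P : (ea w - ea x) * (ea g - ed g) + (eb w - eb x) * ec g
      + (ec w - ec x) * eb g = 0.
    by apply: (lincomb2 1 (- ed g) T2 T1); ring.
  have Q : (ea w - ea x) * (ea h - ed h) + (eb w - eb x) * ec h
      + (ec w - ec x) * eb h = 0.
    by apply: (lincomb2 1 (- ed h) T3 T1); ring.
  have E12 : (ea w - ea x) * comm12 g h = (eb w - eb x) * comm11 g h.
    by apply: (lincomb2 (eb h) (- eb g) P Q); rewrite /comm12 /comm11; ring.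
  have E13 : (ea w - ea x) * comm21 g h = (ec w - ec x) * comm11 g h.
    by apply: (lincomb2 (- ec h) (ec g) P Q); rewrite /comm21 /comm11; ring.
  have E23 : (eb w - eb x) * comm21 g h = (ec w - ec x) * comm12 g h.
    by apply: (lincomb2 (ea h - ed h) (- (ea g - ed g)) P Q); rewrite /comm21 /comm12; ring.
  have Ed : ed w = ed x - (ea w - ea x) by apply: (lincomb1 1 T1); ring.
  rewrite Ed; have [n1|n1] := eqVneq (comm11 g h) 0; last first.
    exists ((ea w - ea x) / comm11 g h); split; try by field.
    - by apply: (addIr (- eb x)); apply: (mulIf n1); rewrite -E12; field.
    - by apply: (addIr (- ec x)); apply: (mulIf n1); rewrite -E13; field.
  move: k0; rewrite /commdet n1 expr0n add0r mulf_eq0 negb_or => /andP[n2 n3].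
  have a0 : ea w - ea x = 0 by apply: (mulIf n2); rewrite E12 n1; ring.
  exists ((eb w - eb x) / comm12 g h); split; try by field.
  - by apply: (lincomb1 1 a0); rewrite ?n1; ring.
  - by apply: (addIr (- ec x)); apply: (mulIf n2); rewrite -E23; field.
  - by apply: (lincomb1 (-1) a0); rewrite ?n1; ring.
have [s [Y1 Y2 Y3 Y4]] := par y fy; have [t [Z1 Z2 Z3 Z4]] := par z fz => yx zx.
have nz w (u : F) : w != x -> ea w = ea x + u * comm11 g h ->
    eb w = eb x + u * comm12 g h -> ec w = ec x + u * comm21 g h ->
    ed w = ed x - u * comm11 g h -> u != 0.
  move=> wx H1 H2 H3 H4; apply: contra wx => /eqP u0; apply/eqP.
  by apply: gl2P; rewrite ?H1 ?H2 ?H3 ?H4 ?u0; ring.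
have s0 := nz y s yx Y1 Y2 Y3 Y4; have t0 := nz z t zx Z1 Z2 Z3 Z4.
(* Along the line, determinant one is a quadratic equation in [u] with leading coefficient
   [- commdet g h]. The point [x] accounts for the root 0, so only one nonzero root remains. *)
have root w (u : F) : u != 0 -> ea w * ed w - eb w * ec w = 1 ->
    ea w = ea x + u * comm11 g h ->
    eb w = eb x + u * comm12 g h -> ec w = ec x + u * comm21 g h ->
    ed w = ed x - u * comm11 g h ->
    u * commdet g h = comm11 g h * (ed x - ea x) - eb x * comm21 g h - ec x * comm12 g h.
  move=> u0 dw H1 H2 H3 H4; apply: (mulfI u0).
  move: dw; rewrite H1 H2 H3 H4 => dw.
  by apply: (lincomb2 (-1) 1 dw dx); rewrite /commdet; ring.
have := root y s s0 dy Y1 Y2 Y3 Y4; rewrite -(root z t t0 dz Z1 Z2 Z3 Z4).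
move/(mulIf k0) => st; apply: gl2P;
by rewrite ?Y1 ?Y2 ?Y3 ?Y4 ?Z1 ?Z2 ?Z3 ?Z4 st.
Qed.

(** A factorization of [v] is determined by its factor [y] in the torus, and [tr (v * y^-1) = t]
    allows at most two choices of [y]. *)
Lemma card_class_cent a t (Z E : {set gT}) : a \in SL F -> regular a -> t != 0 ->
  Z \subset SL F -> (forall z, z \in Z -> tr z = t) ->
  E \subset SL F :&: 'C[a]%g -> (#|Z| * #|E| <= 2 * #|(Z * E)%g|)%N.
Proof.
move=> aS ra t0 ZS Zt EC; rewrite -cardsX.
have -> : (Z * E)%g = [set (u.1 * u.2)%g | u in setX Z E].
  apply/setP => z; apply/mulsgP/imsetP => [[x y xZ yE ->]|[[x y]]].
    by exists (x, y); rewrite // inE xZ.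
  by rewrite inE => /andP[xZ yE] ->; exists x y.
apply: card_le_fiber => -[x y] /setXP[/= xZ yE].
set X := [set _ in _ | _].
have inj : {in X &, injective (fun v : gT * gT => v.2^-1%g)}.
  move=> [x1 y1] [x2 y2]; rewrite !inE /= => /andP[_ /eqP e1] /andP[_ /eqP e2].
  by move=> /invg_inj ey; congr (_, _) => //; apply: (mulIg y1); rewrite e1 ey e2.
rewrite -(card_in_imset inj).
apply: (@card_cent_tr_neq0 _ a (x * y)%g t) => //.
move=> _ /imsetP[[x1 y1] /setIdP[/setXP[/= x1Z y1E] /eqP e] ->] /=.
have /(subsetP EC)/setIP[yS yC] := y1E; split.
- by rewrite groupV.
- by apply/commuteV/esym/cent1P.
- by rewrite -e mulgK Zt.
Qed.

End Traces.

(** * Growth of balls *)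

Section Arithmetic.
Implicit Types K a N tau e T q : nat.

Lemma traces_arith K a tau : 128 <= K -> K ^ 11 <= a -> a <= 2 * tau ^ 3 ->
  K ^ 3 <= tau.
Proof.
move=> K128 Ka a_tau; have Kpos : 0 < K by apply: leq_trans K128.
rewrite leqNgt; apply/negP => lt; have := leq_trans Ka a_tau.
apply/negP; rewrite -ltnNge; apply: (@leq_ltn_trans (2 * (K ^ 3) ^ 3)).
  by rewrite leq_mul2l leq_exp2r // ltnW.
rewrite -expnM (expnD K 9 2) mulnC ltn_pmul2l ?expn_gt0 ?Kpos //.
by apply: (@leq_trans (128 ^ 2)); rewrite // leq_exp2r.
Qed.

(** Numerical side of the pivot: [a] and [N] are the sizes of the ball and of the ball of six times
    the radius, [tau] the number of traces, [e0] and [e] the intersections with the torus of a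
    sparse class and with a conjugate torus. Chaining the three inequalities gives
    [tau <= 13 * K ^ 3], against [tau ^ 3 >= a / 2 >= K ^ 11 / 2]. *)
Lemma pivot_arith K a N tau (e0 : nat) e : 128 <= K -> N <= K * a -> K ^ 11 <= a ->
  a <= 2 * tau ^ 3 -> (tau - 3) * a <= N * e0 -> a * e0 <= 2 * N * e ->
  a * e <= 6 * N -> False.
Proof.
move=> K128 NK Kbig a_tau He0 H2 H1; have Kpos : 0 < K by apply: leq_trans K128.
have apos : 0 < a by apply: leq_trans Kbig; rewrite expn_gt0 Kpos.
have H3 : a ^ 2 * e0 <= 12 * N ^ 2.
  apply: (@leq_trans (a * (2 * N * e))).
    by rewrite expnS expn1 -mulnA leq_mul2l H2 orbT.
  apply: (@leq_trans (2 * N * (6 * N))); last by apply/eq_leq; ring.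
  by rewrite mulnCA leq_mul2l H1 orbT.
have H4 : (tau - 3) * a ^ 3 <= 12 * K ^ 3 * a ^ 3.
  apply: (@leq_trans (N * e0 * a ^ 2)).
    by rewrite (expnS a 2) mulnA leq_mul2r He0 orbT.
  apply: (@leq_trans (N * (12 * N ^ 2))).
    by rewrite -mulnA leq_mul2l (mulnC e0) H3 orbT.
  apply: (@leq_trans (12 * N ^ 3)); first by apply/eq_leq; ring.
  by rewrite -mulnA -expnMn leq_mul2l leq_exp2r.
rewrite leq_pmul2r ?expn_gt0 ?apos // in H4.
have H5 : tau <= 13 * K ^ 3.
  have : 3 <= K ^ 3.
    by apply: leq_trans (leq_pexp2l Kpos (isT : 1 <= 3)); apply: leq_trans K128.
  by move: H4; move: (K ^ 3) => k3; clear; lia.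
have := leq_trans Kbig a_tau; apply/negP; rewrite -ltnNge.
apply: (@leq_ltn_trans (2 * (13 * K ^ 3) ^ 3)).
  by rewrite leq_mul2l leq_exp2r.
rewrite expnMn mulnA -expnM (expnD K 9 2) (mulnC (K ^ 9)).
rewrite ltn_pmul2r ?expn_gt0 ?Kpos //.
by apply: (@leq_trans (128 * 128)); rewrite // -mulnn leq_mul.
Qed.

(** Here [T] is the number of tori. Since [tau >= K ^ 3], the terms coming from [6 * T] and from 3
    are absorbed, leaving [T * tau <= 4 * K ^ 3 * a]. Cubing this and inserting [a <= 2 * tau ^ 3]
    and the bound on [T] compares [q ^ 6] with [a ^ 2]. *)
Lemma tori_arith K a N tau (e0 : nat) T q : 128 <= K -> N <= K * a -> K ^ 11 <= a ->
  a <= 2 * tau ^ 3 -> (tau - 3) * a <= N * e0 ->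
  T * (a * e0) <= 2 * N * (N + 6 * T) -> q * q.-1 <= 4 * T -> 1 < q ->
  q ^ 6 <= K ^ 12 * a ^ 2.
Proof.
move=> K128 NK Kbig a_tau He0 Hc HT q2.
have Kpos : 0 < K by apply: leq_trans K128.
have apos : 0 < a by apply: leq_trans Kbig; rewrite expn_gt0 Kpos.
have tau_big := traces_arith K128 Kbig a_tau.
have H1 : T * (a ^ 2 * (tau - 3)) <= a ^ 2 * (2 * K ^ 3 * a + 12 * K ^ 2 * T).
  apply: (@leq_trans (T * (a * (N * e0)))).
    rewrite (_ : a ^ 2 * _ = a * ((tau - 3) * a)); last by ring.
    by rewrite !leq_mul2l He0 !orbT.
  apply: (@leq_trans (N * (2 * N * (N + 6 * T)))).
    by apply: leq_trans (leq_mul (leqnn N) Hc); apply/eq_leq; ring.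
  apply: (@leq_trans (2 * N ^ 3 + 12 * N ^ 2 * T)); first by apply/eq_leq; ring.
  apply: (@leq_trans (2 * (K * a) ^ 3 + 12 * (K * a) ^ 2 * T)).
    by rewrite leq_add ?leq_mul ?leq_exp2r //.
  by apply/eq_leq; ring.
have {}H1 : T * (tau - 3) <= 2 * K ^ 3 * a + 12 * K ^ 2 * T.
  by rewrite -(@leq_pmul2l (a ^ 2)) ?expn_gt0 ?apos // mulnCA.
have H2 : T * tau <= 4 * K ^ 3 * a.
  have K2 : 128 * K ^ 2 <= K ^ 3 by rewrite (expnS K 2) leq_mul2r K128 orbT.
  have K2pos : 128 <= K ^ 2.
    by apply: leq_trans K128 _; rewrite -{1}(expn1 K) leq_pexp2l.
  move: H1 tau_big K2 K2pos; rewrite mulnBr -[2 * _ * a]mulnA -[12 * _ * T]mulnA -[4 * _ * a]mulnA.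
  move: (K ^ 3 * a) (K ^ 3) (K ^ 2) => A k3 k2 H1 tau_big K2 K2pos.
  have : T * (2 * (3 + 12 * k2)) <= T * tau.
    by rewrite leq_mul2l; apply/orP; right; clear -tau_big K2 K2pos; lia.
  by clear -H1; lia.
have H3 : q ^ 2 * tau <= 32 * K ^ 3 * a.
  have H : q ^ 2 <= 8 * T.
    rewrite -mulnn; have H : q * q <= 2 * (q * q.-1).
      by rewrite mulnCA leq_mul2l; clear -q2; lia.
    by apply: leq_trans H _; clear -HT; lia.
  apply: leq_trans (leq_mul H (leqnn tau)) _.
  by rewrite -mulnA; apply: leq_trans (leq_mul (leqnn 8) H2) _; apply/eq_leq; ring.
rewrite -(leq_pmul2r apos); apply: (@leq_trans (q ^ 6 * (2 * tau ^ 3))).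
  by rewrite leq_mul2l a_tau orbT.
apply: (@leq_trans (2 * (q ^ 2 * tau) ^ 3)); first by apply/eq_leq; ring.
apply: (@leq_trans (2 * (32 * K ^ 3 * a) ^ 3)).
  by rewrite leq_mul2l leq_exp2r.
rewrite (_ : 2 * _ = (2 * 32 ^ 3) * (K ^ 9 * a ^ 3)); last by ring.
rewrite (_ : K ^ 12 * _ * _ = K ^ 3 * (K ^ 9 * a ^ 3)); last by ring.
rewrite leq_mul2r; apply/orP; right.
rewrite (_ : 32 = 2 ^ 5) // -expnM -expnS.
apply: (@leq_trans ((2 ^ 7) ^ 3)); first by rewrite -expnM leq_exp2l.
by rewrite leq_exp2r.
Qed.

End Arithmetic.

(** * Orders of the group and of its tori *)

Section OrderSL.
Variable F : finFieldType.
Local Notation gT := (gl2 F).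
Local Open Scope ring_scope.

Lemma card_same_column (A : {set gT}) a c : A \subset SL F ->
  (forall x, x \in A -> ea x = a /\ ec x = c) -> (#|A| <= #|F|)%N.
Proof.
move=> AS H; have [a0|a0] := eqVneq a 0.
  have inj : {in A &, injective (@ed F)}.
    move=> x y xA yA e; have [x1 x2] := H x xA; have [y1 y2] := H y yA.
    have /SLP := subsetP AS _ xA; have /SLP := subsetP AS _ yA.
    rewrite x1 x2 y1 y2 a0 !mul0r !sub0r => Ey Ex.
    have c0 : c != 0.
      by apply/eqP => c0; move/eqP: Ex; rewrite c0 mulr0 oppr0 eq_sym oner_eq0.
    apply: gl2P; rewrite ?x1 ?x2 ?y1 ?y2 //.
    by apply: (mulIf c0); apply: oppr_inj; rewrite Ex Ey.
  by rewrite -(card_in_imset inj) max_card.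
have inj : {in A &, injective (@eb F)}.
  move=> x y xA yA e; have [x1 x2] := H x xA; have [y1 y2] := H y yA.
  have /SLP := subsetP AS _ xA; have /SLP := subsetP AS _ yA.
  rewrite x1 x2 y1 y2 e => Ey Ex.
  apply: gl2P; rewrite ?x1 ?x2 ?y1 ?y2 //.
  by apply: (mulfI a0); apply: (addIr (- (eb y * c))); rewrite Ex Ey.
by rewrite -(card_in_imset inj) max_card.
Qed.

Lemma card_columns (A : {set gT}) : A \subset SL F ->
  (#|A| <= #|F| * #|[set (ea x, ec x) | x in A]|)%N.
Proof.
move=> AS; apply: card_le_fiber => x xA.
apply: (@card_same_column _ (ea x) (ec x)).
  by apply/subsetP => y /setIdP[yA _]; apply: (subsetP AS).
by move=> y /setIdP[_ /eqP[-> ->]].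
Qed.

Lemma card_SL_le : (#|SL F| <= #|F| ^ 3)%N.
Proof.
apply: leq_trans (card_columns (subxx _)) _.
by rewrite expnS leq_mul2l -mulnn -card_prod max_card orbT.
Qed.

Lemma card_SL_ge : (#|F|.-1 * #|F| ^ 2 <= #|SL F|)%N.
Proof.
pose f (u : F * (F * F)) := mkSL u.1 u.2.1 u.2.2 ((1 + u.2.1 * u.2.2) / u.1).
pose D := setX [set~ (0 : F)] [set: F * F].
have detf u : u \in D -> u.1 * ((1 + u.2.1 * u.2.2) / u.1) - u.2.1 * u.2.2 = 1.
  by rewrite !inE andbT => u0; field.
have inj : {in D &, injective f}.
  move=> u v uD vD; have [H1 H2 H3 _] := mkSLE (detf u uD).
  have [H1' H2' H3' _] := mkSLE (detf v vD) => e.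
  case: u v {uD vD} e H1 H2 H3 H1' H2' H3' => [u1 [u2 u3]] [v1 [v2 v3]] /=.
  by rewrite /f /= => -> -> -> -> <- <- <-.
rewrite -[X in (X * _ <= _)%N](_ : #|[set~ (0 : F)]| = _); last first.
  by rewrite cardsC1.
rewrite -mulnn -card_prod -cardsT -cardsX -(card_in_imset inj).
by apply/subset_leq_card/subsetP => _ /imsetP[u uD ->]; apply/mkSL_SL/detf.
Qed.

Lemma card_cent_SL a : a \in SL F -> regular a -> (2 : F) != 0 ->
  (#|SL F :&: 'C[a]%g| <= 2 * #|F|)%N.
Proof.
move=> aS ra ch; apply: leq_trans (card_le_fiber (f := @tr F) (k := 2) _) _.
  move=> x _; apply: (@card_cent_tr _ a 1%g (tr x)) => //.
    by rewrite tr1 => -[/eqP]; rewrite (negPf ch).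
  move=> y /setIdP[/setIP[yS /cent1P yC] /eqP ey].
  by split; rewrite ?mul1g.
by rewrite leq_mul2l max_card.
Qed.

End OrderSL.

(** * The pivot argument *)

Section Growth.
Variable F : finFieldType.
Local Notation gT := (gl2 F).
Hypothesis charF : (2 : F)%R != 0%R.
Variables (S : {set gT}) (g h : gT) (r : nat).
Hypotheses (genS : <<S>>%g = SL F) (gS : g \in S) (hS : h \in S).
Hypotheses (gh0 : commdet g h != 0%R) (r0 : 0 < r).
Implicit Types (x y a b u : gT) (t : F).

Let B k : {set gT} := word_ball S (k * r).
Let K0 := #|B 1|.
Let N := #|B 6|.
Let tau := #|(@tr F) @: B 2|.
Let q := #|F|.

Let SS : S \subset SL F. Proof. by rewrite -genS subset_gen. Qed.
Let BS k : B k \subset SL F. Proof. exact: (@ball_sub _ S (SL_group F)). Qed.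
Let BM k l x y : x \in B k -> y \in B l -> (x * y)%g \in B (k + l).
Proof. by rewrite /B mulnDl; apply: ball_mul. Qed.
Let BW k l : k <= l -> B k \subset B l.
Proof. by move=> kl; rewrite sub_ball // leq_mul2r kl orbT. Qed.
Let BV k x : x \in B k -> x^-1%g \in B k. Proof. exact: ballV. Qed.
Let SB x : x \in S -> x \in B 1.
Proof. by move=> xS; rewrite gen_sub_ball // mul1n. Qed.
Let BleN k : k <= 6 -> #|B k| <= N.
Proof. by move=> k6; apply/subset_leq_card/BW. Qed.

Lemma card_ball_traces : K0 <= 2 * tau ^ 3.
Proof.
by apply: (card_trace_coords gh0 (BS 1) (BW (isT : 1 <= 2))) => x xB;
  apply: (BM xB); apply: SB.
Qed.

(** Excluding 2 and -2 gives regularity; excluding 0 is what [card_class_cent] requires. *)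
Definition generic_tr t := [&& t != 0, t != 2 & t != -2]%R.

Lemma generic_regular a : generic_tr (tr a) -> regular a.
Proof.
move=> /and3P[_ t2 t2']; rewrite /regular.
have -> : (4 = 2 ^+ 2 :> F)%R by ring.
by rewrite eqf_sqr negb_or t2.
Qed.

(** Averaging: at least [tau - 3] generic traces occur in [B 2], and the corresponding parts of
    [B 4] are disjoint. *)
Lemma exists_sparse_class : 3 < tau -> exists2 a, a \in B 2 & generic_tr (tr a) /\
  (tau - 3) * #|[set x in B 4 | tr x == tr a]| <= N.
Proof.
move=> tau3; pose T := (@tr F) @: B 2 :\: [set 0; 2; -2]%R.
have cardT : tau - 3 <= #|T|.
  rewrite cardsD leq_sub2l //; apply: leq_trans (subset_leq_card (subsetIr _ _)) _.
  by rewrite -setUA !cardsU1 cards1; case: (_ \notin _); case: (_ \notin _).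
have [|/forall_inPn[t tT Ht]] :=
    boolP [forall (t | t \in T), N < (tau - 3) * #|[set x in B 4 | tr x == t]|].
  move/forall_inP => Hall; exfalso.
  have sumN : \sum_(t in T) #|[set x in B 4 | tr x == t]| <= N.
    apply: leq_trans (BleN (isT : 4 <= 6)).
    rewrite -sum1_card (partition_big (@tr F) predT) //=.
    rewrite [X in _ <= X](bigID (mem T)) /=; apply: leq_trans (leq_addr _ _).
    by apply: leq_sum => t tT; rewrite -sum1_card; apply/eq_leq/eq_bigl => x; rewrite inE.
  have T0 : 0 < #|T| by apply: leq_trans cardT; rewrite subn_gt0.
  have : \sum_(t in T) N.+1 <= \sum_(t in T) (tau - 3) * #|[set x in B 4 | tr x == t]|.
    by apply: leq_sum => t tT; apply: Hall.
  rewrite sum_nat_const -big_distrr /= => /leq_trans/(_ (leq_mul cardT sumN)).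
  by rewrite leq_pmul2l // ltnn.
rewrite -leqNgt in Ht; case/setDP: tT => /imsetP[a aB ta].
rewrite !inE !negb_or -andbA => gt; exists a => //.
by rewrite -ta; split.
Qed.

(** Conjugates of [a] by [B 1] stay in [B 4] with the same trace, so the orbit is small and the
    stabilizer large. *)
Lemma sparse_class_cent a : a \in B 2 ->
  (tau - 3) * #|[set x in B 4 | tr x == tr a]| <= N ->
  (tau - 3) * K0 <= N * #|B 2 :&: 'C[a]%g|.
Proof.
move=> aB sparse.
have H := @card_orbit_le _ (B 1) (B 2) a (fun x y xB yB => BM (BV xB) yB).
apply: leq_trans (leq_mul (leqnn _) H) _.
rewrite mulnCA mulnC leq_mul2r; apply/orP; right.
apply: leq_trans sparse; rewrite leq_mul2l subset_leq_card ?orbT //.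
apply/subsetP => _ /imsetP[x xB ->]; rewrite inE trJ eqxx andbT.
by rewrite conjgE invgK mulgA; apply: (@BM 3 1) => //; [apply: (@BM 1 2)|apply: BV].
Qed.

(** The orbit of [b] under [B 1] is a set of constant trace in [B 4]. Its product with [B 2 :&:
    'C[a]] lies in [B 6] and is nearly as large as possible, so the orbit is small and the
    stabilizer of [b] in [B 2] is large. *)
Lemma generic_cent_large a b : a \in B 2 -> b \in B 2 -> generic_tr (tr a) ->
  generic_tr (tr b) ->
  K0 * #|B 2 :&: 'C[a]%g| <= 2 * N * #|B 2 :&: 'C[b]%g|.
Proof.
move=> aB bB ga gb.
have H := @card_orbit_le _ (B 1) (B 2) b (fun x y xB yB => BM (BV xB) yB).
apply: leq_trans (leq_mul H (leqnn _)) _.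
rewrite -mulnA mulnC leq_mul2r; apply/orP; right.
set Z := [set _ | _ in _].
have ZB : Z \subset B 4.
  apply/subsetP => _ /imsetP[x xB ->].
  by rewrite conjgE invgK mulgA; apply: (@BM 3 1) => //; [apply: (@BM 1 2)|apply: BV].
have := @card_class_cent F a (tr b) Z (B 2 :&: 'C[a]%g) (subsetP (BS 2) _ aB)
          (generic_regular ga).
case/and3P: (gb) => b0 _ _ => /(_ b0 (subset_trans ZB (BS 4))) H'.
apply: leq_trans (H' _ _) _.
- by move=> _ /imsetP[x _ ->]; rewrite trJ.
- by rewrite setSI.
rewrite leq_mul2l /= /N; apply/subset_leq_card/subsetP => _ /mulsgP[x y xZ yB ->].
by apply: (@BM 4 2); [apply: (subsetP ZB)|move: yB; rewrite inE => /andP[]].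
Qed.

Lemma card_nongeneric_cent a (E : {set gT}) : a \in SL F -> regular a ->
  E \subset SL F :&: 'C[a]%g -> (forall x, x \in E -> ~~ generic_tr (tr x)) ->
  #|E| <= 6.
Proof.
move=> aS ra EC Eg.
have le2 t : #|[set x in E | tr x == t]| <= 2.
  apply: (@card_cent_tr _ a 1%g t) => //.
    by rewrite tr1 => -[/eqP]; rewrite (negPf charF).
  move=> y /setIdP[/(subsetP EC)/setIP[yS /cent1P yC] /eqP ey].
  by split; rewrite ?mul1g.
have -> : E = [set x in E | tr x == 0%R] :|: [set x in E | tr x == 2%R]
                :|: [set x in E | tr x == (-2)%R].
  apply/setP => x; rewrite !inE -!andb_orr; case xE: (x \in E) => //=.
  by have := Eg x xE; rewrite /generic_tr !negb_and !negbK orbA => ->.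
apply: leq_trans (leq_card_setU _ _) _.
apply: (@leq_trans ((2 + 2) + 2)) => //; apply: leq_add => //.
by apply: leq_trans (leq_card_setU _ _) _; apply: leq_add.
Qed.

(** A generic witness, not just a nontrivial one: it is regular, so its centralizer is this torus
    and [generic_cent_large] transfers to it. *)
Definition involved a x := [exists b in B 2 :&: 'C[a ^ x]%g, generic_tr (tr b)].

Lemma cent1_eq a b : a \in SL F -> b \in SL F -> regular a -> regular b ->
  commute a b -> 'C[a]%g = 'C[b]%g.
Proof.
move=> aS bS ra rb cab; apply/setP => x; apply/cent1P/cent1P => cx.
  exact: (cent_regular_comm aS ra (esym cx) cab).
exact: (cent_regular_comm bS rb (esym cx) (esym cab)).
Qed.

Lemma regularJ a x : regular (a ^ x)%g = regular a.
Proof. by rewrite /regular trJ. Qed.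

Lemma involved_cent_large a x : a \in B 2 -> generic_tr (tr a) -> x \in SL F ->
  involved a x ->
  K0 * #|B 2 :&: 'C[a]%g| <= 2 * N * #|B 2 :&: 'C[a ^ x]%g|.
Proof.
move=> aB ga xS /existsP[b /andP[/setIP[bB bC] gb]].
rewrite (@cent1_eq (a ^ x)%g b) ?regularJ ?generic_regular //.
- exact: generic_cent_large.
- by rewrite groupJ // (subsetP (BS 2)).
- exact: (subsetP (BS 2)).
- by apply/esym/cent1P.
Qed.

(* A torus that is not involved has small intersection with B 2,
   so its translates by B 1 of a rich subset are almost disjoint. *)
Lemma pivot a x s : a \in B 2 -> generic_tr (tr a) -> x \in SL F -> s \in S ->
  ~~ involved a (x * s)%g -> K0 * #|B 2 :&: 'C[a ^ x]%g| <= 6 * N.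
Proof.
move=> aB ga xS sS ninv.
have asS : (a ^ (x * s))%g \in SL F.
  by rewrite groupJ ?groupM ?(subsetP (BS 2) _ aB) ?(subsetP SS _ sS).
pose E := ((B 2 :&: 'C[a ^ x]) :^ s)%g.
have EC : E \subset 'C[a ^ (x * s)]%g.
  by rewrite conjgM cent1J conjSg subsetIr.
have := @card_mul_le _ (B 1) E 'C[a ^ (x * s)]%G 6 EC.
rewrite [#|E|]cardJg => H; apply: leq_trans (H _) _; last first.
  rewrite leq_mul2l /=; apply/subset_leq_card/subsetP => _ /mulsgP[y z yB zE ->].
  move: zE; rewrite mem_conjg inE => /andP[zB _]; apply: (@BM 1 5) => //.
  apply: (subsetP (BW (isT : 4 <= 5))).
  rewrite -(conjgKV s z) conjgE; apply: (@BM 1 3).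
    by apply: BV; apply: SB.
  by apply: (@BM 2 1) => //; apply: SB.
(* Elements of [B 1] in one coset of the new torus differ by elements of [B 2] in that torus. None
   of these is generic, so there are at most six. *)
move=> y yB; rewrite -(card_imset _ (mulgI y^-1%g)).
apply: (@card_nongeneric_cent (a ^ (x * s))%g) => //.
- by rewrite regularJ generic_regular.
- apply/subsetP => _ /imsetP[z /setIdP[zB zC] ->]; rewrite inE zC andbT.
  by rewrite groupM ?groupV ?(subsetP (BS 1)).
- move=> _ /imsetP[z /setIdP[zB zC] ->].
  move: ninv; rewrite negb_exists => /forallP/(_ (y^-1 * z)%g).
  by rewrite inE zC (@BM 1 1) ?BV.
Qed.

Lemma all_involved a : generic_tr (tr a) -> a \in B 2 ->
  (forall x s, x \in SL F -> s \in S -> involved a x -> involved a (x * s)%g) ->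
  forall x, x \in SL F -> involved a x.
Proof.
move=> ga aB step x; rewrite -genS => /gen_prodgP[n [c cS ->]].
elim: n c cS => [|n IHn] c cS.
  rewrite big_ord0; apply/existsP; exists a.
  by rewrite conjg1 inE aB ga cent1id.
rewrite big_ord_recr /=; apply: step; rewrite ?cS //; last by apply: IHn => i.
by apply: (@group_prod _ (SL_group F)) => i _; apply: (subsetP SS).
Qed.

Let tori a : {set {set gT}} := [set 'C[a ^ x]%g | x in SL F].

(** A torus contains at most two conjugates of [a], as they share its trace, and each conjugate
    comes from at most [2 * q] elements [x]; so every torus is obtained at most [4 * q] times. *)
Lemma card_tori a : a \in SL F -> regular a -> q * q.-1 <= 4 * #|tori a|.
Proof.
move=> aS ra; have q0 : 0 < q by apply/card_gt0P; exists 0%R.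
have H : #|SL F| <= 4 * q * #|tori a|.
  apply: card_le_fiber => x xS; set Y := [set _ in _ | _].
  apply: (@leq_trans (2 * q * #|[set a ^ y | y in Y]%g|)).
    apply: card_le_fiber => y /setIdP[yS _].
    apply: leq_trans (card_cent_SL aS ra charF).
    rewrite -(card_imset _ (mulIg y^-1%g)); apply/subset_leq_card/subsetP.
    move=> _ /imsetP[z /setIdP[/setIdP[zS _] /eqP e] ->].
    rewrite inE groupM ?groupV //=.
    by apply/cent1P/esym/commgP/conjg_fixP; rewrite conjgM e conjgK.
  rewrite (_ : 4 * q = 2 * q * 2); last by ring.
  rewrite leq_mul2l; apply/orP; right.
  have axS : (a ^ x)%g \in SL F by rewrite groupJ.
  apply: (@card_cent_tr _ (a ^ x)%g 1%g (tr a)) => //.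
  - by rewrite regularJ.
  - by rewrite tr1 => -[/eqP]; rewrite (negPf charF).
  move=> _ /imsetP[y /setIdP[yS /eqP e] ->]; split.
  - by rewrite groupJ.
  - by apply/esym/cent1P; rewrite -e cent1id.
  - by rewrite mul1g trJ.
rewrite -(leq_pmul2l q0); apply: leq_trans (_ : q.-1 * q ^ 2 <= _).
  by rewrite expnS expn1; apply/eq_leq; ring.
by apply: leq_trans (card_SL_ge F) (leq_trans H _); apply/eq_leq; ring.
Qed.

(** Summation over all tori: a generic element determines its torus, so the generic parts of [B 2]
    are disjoint, and each torus adds at most six nongeneric elements. *)
Lemma all_involved_count a : a \in B 2 -> generic_tr (tr a) ->
  (forall x, x \in SL F -> involved a x) ->
  #|tori a| * (K0 * #|B 2 :&: 'C[a]%g|) <= 2 * N * (N + 6 * #|tori a|).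
Proof.
move=> aB ga inv; have aS := subsetP (BS 2) _ aB.
rewrite -sum_nat_const.
apply: (@leq_trans (\sum_(T in tori a) 2 * N * #|B 2 :&: T|)).
  by apply: leq_sum => _ /imsetP[x xS ->]; apply: involved_cent_large => //; apply: inv.
rewrite -big_distrr leq_mul2l; apply/orP; right.
pose Q := [set b in B 2 | generic_tr (tr b)].
apply: (@leq_trans (\sum_(T in tori a) (#|[set b in Q | 'C[b]%g == T]| + 6))).
  apply: leq_sum => _ /imsetP[x xS ->].
  have axS : (a ^ x)%g \in SL F by rewrite groupJ.
  have rx : regular (a ^ x)%g by rewrite regularJ generic_regular.
  rewrite -(cardsID Q (B 2 :&: _)); apply: leq_add.
    apply/subset_leq_card/subsetP => b /setIP[/setIP[bB /cent1P bC] bQ].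
    have /setIdP[_ gb] := bQ; rewrite inE bQ; apply/eqP/esym/cent1_eq => //.
    - exact: (subsetP (BS 2)).
    - exact: generic_regular.
  apply: (@card_nongeneric_cent (a ^ x)%g) => //.
    by apply/subsetP => b /setDP[/setIP[/(subsetP (BS 2)) bS bC] _]; rewrite inE bS.
  by move=> b /setDP[/setIP[bB _]]; rewrite inE bB.
rewrite big_split /= sum_nat_const (mulnC 6) leq_add2r.
apply: (@leq_trans #|Q|); last first.
  apply: leq_trans (BleN (isT : 2 <= 6)); apply/subset_leq_card/subsetP => b.
  by rewrite inE => /andP[].
rewrite -[X in _ <= X]sum1_card (partition_big (fun b => 'C[b]%g) predT) //=.
rewrite [X in _ <= X](bigID (mem (tori a))) /=; apply: leq_trans (leq_addr _ _).
by apply: leq_sum => t tT; rewrite -sum1_card; apply/eq_leq/eq_bigl => x; rewrite inE.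
Qed.

(** The conclusion reads [K0 >= q ^ 3 / K ^ 6]. Either involvement propagates along the generators
    to every torus, or some generator leads from an involved torus to one that is not, which is
    numerically impossible. *)
Theorem growth_dichotomy K : 128 <= K -> N <= K * K0 -> K ^ 11 <= K0 ->
  q ^ 6 <= K ^ 12 * K0 ^ 2.
Proof.
move=> K128 NK Kbig; have tau_big := traces_arith K128 Kbig card_ball_traces.
have tau3 : 3 < tau.
  apply: leq_trans tau_big; apply: leq_trans (leq_pexp2l _ (isT : 1 <= 3)); last first.
    exact: leq_trans K128.
  by apply: leq_trans K128.
have [a aB [ga sparse]] := exists_sparse_class tau3.
have aS := subsetP (BS 2) _ aB; have ra := generic_regular ga.
have He0 := sparse_class_cent aB sparse.
have [step|] := boolP [forall (x | x \in SL F), forall (s | s \in S),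
                        involved a x ==> involved a (x * s)%g]; last first.
  move=> /forall_inPn[x xS /forall_inPn[s sS]]; rewrite negb_imply => /andP[inv ninv].
  have H1 := pivot aB ga xS sS ninv; have H2 := involved_cent_large aB ga xS inv.
  by case: (pivot_arith K128 NK Kbig card_ball_traces He0 H2 H1).
have inv : forall x, x \in SL F -> involved a x.
  apply: all_involved => // x s xS sS.
  by move/forall_inP/(_ x xS)/forall_inP/(_ s sS)/implyP: step.
apply: (tori_arith K128 NK Kbig card_ball_traces He0 (all_involved_count aB ga inv)).
  exact: card_tori.
exact: card_finNzRing_gt1.
Qed.

End Growth.

(** * Sets of nearly full size *)

Section CauchySchwarz.
Variables T U : finType.

Lemma sqr_sum_le (Z : {set U}) (n : U -> nat) :
  (\sum_(z in Z) n z) ^ 2 <= #|Z| * \sum_(z in Z) n z ^ 2.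
Proof.
rewrite -(leq_pmul2l (isT : 0 < 2)) -mulnn big_distrlr big_distrr /=.
apply: (@leq_trans (\sum_(z in Z) \sum_(w in Z) (n z ^ 2 + n w ^ 2))).
  apply: leq_sum => z _; rewrite big_distrr /=; apply: leq_sum => w _.
  exact: (nat_Cauchy (n z) (n w)).
apply/eq_leq; under eq_bigr do rewrite big_split /= sum_nat_const.
by rewrite big_split /= sum_nat_const -big_distrr /= mul2n addnn.
Qed.

Lemma sqr_card_le (f : T -> U) (A : {set T}) :
  #|A| ^ 2 <= #|f @: A| * #|[set u in setX A A | f u.1 == f u.2]|.
Proof.
have -> : #|A| = \sum_(z in f @: A) #|[set x in A | f x == z]|.
  rewrite -sum1_card (partition_big_imset f) /=; apply: eq_bigr => z _.
  by rewrite sum1dep_card; apply: eq_card => x; rewrite !inE.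
apply: leq_trans (sqr_sum_le _ _) _; rewrite leq_mul2l; apply/orP; right.
set E := [set _ in _ | _]; have -> : #|E| =
    \sum_(z in f @: A) #|[set u in E | f u.1 == z]|.
  rewrite -sum1_card (partition_big (fun u => f u.1) (mem (f @: A))) /=.
    by apply: eq_bigr => z _; rewrite sum1dep_card; apply: eq_card => x; rewrite !inE.
  by move=> [x y] /setIdP[/setXP[xA _] _]; apply: imset_f.
apply: leq_sum => z _; rewrite -mulnn -cardsX; apply/subset_leq_card/subsetP.
move=> [x y] /setXP[/setIdP[xA /eqP fx] /setIdP[yA /eqP fy]].
by rewrite !inE /= xA yA fx fy eqxx.
Qed.

End CauchySchwarz.

(** * A sum-product estimate through additive energies *)

Section SumProduct.
Variable F : finFieldType.
Implicit Types (X D : {set F}) (d x y t : F).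
Local Notation q := #|F|.

Definition dilate_sum X d : {set F} := [set (u.1 + d * u.2)%R | u in setX X X].

Let energy X d := #|[set v in setX (setX X X) (setX X X) |
  (v.1.1 + d * v.1.2 == v.2.1 + d * v.2.2)%R]|.

(** The equation [x1 + d y1 = x2 + d y2] holds for all [d] if [x1 = x2] and [y1 = y2], for no
    nonzero [d] if exactly one of these holds, and otherwise for at most one [d]. *)
Lemma sum_energy_le X :
  \sum_(d | d != 0%R) energy X d <= #|X| ^ 2 * q.-1 + (#|X| ^ 2 - #|X|) ^ 2.
Proof.
pose XX := setX X X; pose diag := [set v in XX | v.1 == v.2].
have cXX : #|XX| = #|X| ^ 2 by rewrite cardsX mulnn.
have diagXX : diag \subset XX by apply/subsetP => v; rewrite inE => /andP[].
have cdiag : #|diag| = #|X|.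
  have inj : injective (fun x : F => (x, x)) by move=> x y [].
  rewrite -(card_imset _ inj); apply: eq_card => -[x y]; rewrite !inE /=.
  apply/idP/imsetP => [/andP[/andP[xX _] /eqP <-]|[z zX [-> ->]]].
    by exists x.
  by rewrite zX eqxx.
have cnd : #|XX :\: diag| = #|X| ^ 2 - #|X|.
  by rewrite cardsD (setIidPr diagXX) cXX cdiag.
pose G d v := (v.1.1 + d * v.1.2 == v.2.1 + d * v.2.2)%R.
have -> : \sum_(d | d != 0%R) energy X d =
    \sum_(v in setX XX XX) #|[set d | (d != 0%R) && G d v]|.
  rewrite /energy; under eq_bigr do rewrite -sum1dep_card.
  rewrite (exchange_big_dep (mem (setX XX XX))) /=; last by move=> d v _ /andP[].
  apply: eq_bigr => v vX; rewrite sum1dep_card; apply: eq_card => d.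
  by rewrite !inE; move: vX; rewrite !inE => ->.
(* Regroups the quadruple as [(x1, x2)] and [(y1, y2)], so that the cases depend on which of the two
   pairs is diagonal. *)
pose swap (w : (F * F) * (F * F)) := ((w.1.1, w.2.1), (w.1.2, w.2.2)).
have swapK : involutive swap by move=> [[a b] [c e]].
rewrite (reindex_inj (inv_inj swapK)) /=.
rewrite (eq_bigl (fun w => (w.1 \in XX) && (w.2 \in XX))); last first.
  move=> [[a b] [c e]]; rewrite !inE /=.
  by case: (a \in X); case: (b \in X); case: (c \in X); case: (e \in X).
rewrite -(pair_big (mem XX) (mem XX)
  (fun P Q => #|[set d | (d != 0%R) && G d (swap (P, Q))]|)) /=.
rewrite (bigID (mem diag)) /= leq_add //.
  rewrite (eq_bigl (mem diag)); last first.
    by move=> P; rewrite !inE andbA andbb.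
  apply: (@leq_trans (\sum_(P in diag) #|X| * q.-1)); last first.
    by rewrite sum_nat_const cdiag mulnA mulnn.
  apply: leq_sum => -[x1 x2] /setIdP[_ /eqP /= <-].
  rewrite (bigID (mem diag)) /= [X in _ + X]big1 ?addn0.
    rewrite (eq_bigl (mem diag)); last first.
      by move=> P; rewrite !inE andbA andbb.
    rewrite -cdiag -sum_nat_const; apply: leq_sum => Q _.
    rewrite -(cardsC1 (0%R : F)); apply/subset_leq_card/subsetP => d.
    by rewrite !inE => /andP[].
  move=> [y1 y2] /andP[yX]; rewrite [in X in X -> _]inE yX /= => y12.
  apply: eq_card0 => d; rewrite !inE /G /=; apply/negP => /andP[d0 /eqP/addrI/(mulfI d0)].
  exact/eqP.
rewrite (eq_bigl (mem (XX :\: diag))); last first.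
  by move=> P; rewrite !inE andbC; case: (_ && _).
rewrite -cnd -mulnn -[in X in _ <= X]sum_nat_const; apply: leq_sum => -[x1 x2].
move=> /setDP[x12X]; rewrite inE x12X /= => x12.
rewrite (bigID (mem diag)) /= big1 ?add0n; last first.
  move=> [y1 y2] /andP[_]; rewrite inE => /andP[_ /eqP /= <-].
  apply: eq_card0 => d; rewrite !inE /G /=; apply/negP => /andP[d0 /eqP/addIr].
  exact/eqP.
rewrite (eq_bigl (mem (XX :\: diag))); last first.
  by move=> P; rewrite !inE andbC; case: (_ && _).
rewrite -[X in _ <= X]sum1_card; apply: leq_sum => -[y1 y2] /setDP[y12X].
rewrite inE y12X /= => y12; rewrite -(cards1 ((x2 - x1) / (y1 - y2))%R).
apply/subset_leq_card/subsetP => d; rewrite !inE /G /= => /andP[d0 /eqP e].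
have y0 : (y1 - y2 != 0)%R by rewrite subr_eq0.
apply/eqP/(mulIf y0); rewrite divfK //.
by apply: (lincomb1 1 e); ring.
Qed.

(* Every energy is at least #|X| ^ 4 / q, and by [sum_energy_le] their average is
   hardly larger, so few dilates can have an energy twice as large. *)
Lemma exists_large_dilate_sum X D : (forall d, d \in D -> d != 0%R) ->
  q ^ 2 < #|D| * #|X| ^ 2 -> exists2 d, d \in D & q < 2 * #|dilate_sum X d|.
Proof.
move=> D0 big; apply/exists_inP; apply: contraLR big; rewrite negb_exists_in.
move=> /forall_inP small; rewrite -leqNgt.
have CS d : #|X| ^ 4 <= #|dilate_sum X d| * energy X d.
  have := sqr_card_le (fun u => u.1 + d * u.2)%R (setX X X).
  by rewrite cardsX mulnn -expnM.
have leq_q : #|X| <= q by apply: max_card.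
have q0 : 0 < q by apply/card_gt0P; exists 0%R.
(* After multiplication by [q], each nonzero [d] contributes [#|X| ^ 4], and each [d] in [D]
   contributes it twice because its dilate sum is small. *)
have : q.-1 * #|X| ^ 4 + #|D| * #|X| ^ 4 <= q * (#|X| ^ 2 * q.-1 + (#|X| ^ 2 - #|X|) ^ 2).
  apply: leq_trans (leq_mul (leqnn q) (sum_energy_le X)).
  rewrite big_distrr /=.
  apply: (@leq_trans (\sum_(d | d != 0%R) (#|X| ^ 4 + (d \in D) * #|X| ^ 4))).
    rewrite big_split /= sum_nat_const -big_distrl /= leq_add //.
      rewrite leq_mul2r -(cardsC1 (0%R : F)); apply/orP; right.
      by apply/subset_leq_card/subsetP => d; rewrite !inE.
    rewrite leq_mul2r -[#|D|]sum1_card; apply/orP; right.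
    rewrite big_mkcond [X in _ <= X]big_mkcond /=; apply: leq_sum => d _.
    by case: (boolP (d \in D)) => [/D0 ->|_]; rewrite //; case: ifP.
  apply: leq_sum => d _; have [dD|_] := boolP (d \in D); last first.
    by rewrite addn0 (leq_trans (CS d)) // leq_mul2r max_card orbT.
  rewrite mul1n addnn -mul2n; apply: leq_trans (leq_mul (leqnn 2) (CS d)) _.
  by rewrite mulnA leq_mul2r [X in _ || X]leqNgt small ?orbT.
have [->|X0] := posnP #|X|; first by rewrite -mulnn !muln0.
move: X0 leq_q q0; case: #|X| => // n _; case: q => // m nm _ /=.
move: #|D| => dd.
rewrite (_ : n.+1 ^ 2 - n.+1 = n.+1 * n); last by rewrite -mulnn mulnS addKn.
have -> : m * n.+1 ^ 4 + dd * n.+1 ^ 4 = n.+1 ^ 2 * ((m + dd) * n.+1 ^ 2) by ring.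
have -> : m.+1 * (n.+1 ^ 2 * m + (n.+1 * n) ^ 2) =
  n.+1 ^ 2 * (m.+1 * (m + n ^ 2)) by ring.
rewrite leq_pmul2l ?expn_gt0 // mulnDl => H.
rewrite -(leq_add2l (m * n.+1 ^ 2)); apply: leq_trans H _.
by rewrite -!mulnn; nia.
Qed.

End SumProduct.

(** * From nearly full size to the whole group *)

Section LargeSets.
Variable F : finFieldType.
Local Notation gT := (gl2 F).
Local Notation q := #|F|.
Implicit Types (A : {set gT}) (x y b : gT) (t : F).

Definition uppers A : {set F} := [set t | upper t \in (A * A)%g].
Definition diagonals A : {set F} :=
  [set t | (t != 0%R) && [exists b in (A * A)%g, (ec b == 0%R) && (ea b == t)]].

(** Two elements with the same first column differ by an upper unipotent, and there are at most
    [q ^ 2] columns. *)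
Lemma card_uppers A : A \subset SL F -> (forall x, x \in A -> x^-1%g \in A) ->
  #|A| <= #|uppers A| * q ^ 2.
Proof.
move=> AS AV; apply: leq_trans (card_le_fiber (f := fun x => (ea x, ec x)) (k := #|uppers A|) _) _.
  move=> x xA; set E := [set _ in _ | _].
  have key y : y \in E -> (x^-1 * y)%g = upper (eb (x^-1 * y)%g).
    move=> /setIdP[yA /eqP[ay cy]].
    have [h1 h2 h3 h4] := SLV (subsetP AS _ xA).
    have /SLP dx := subsetP AS _ xA; have /SLP dy := subsetP AS _ yA.
    apply: gl2P; rewrite !entUL ?h1 ?h2 ?h3 ?h4 ?ay ?cy.
    - by apply: (lincomb1 1 dx); ring.
    - by [].
    - by ring.
    - by rewrite -dy ay cy; ring.
  have inj : {in E &, injective (fun y => eb (x^-1 * y)%g)}.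
    move=> y z yE zE /= e; apply: (mulgI x^-1%g).
    by rewrite key // e -key.
  rewrite -(card_in_imset inj); apply/subset_leq_card/subsetP.
  move=> _ /imsetP[y yE ->]; rewrite /uppers inE -key // mem_mulg //; first exact: AV.
  by move: yE => /setIdP[].
by rewrite leq_mul2l -mulnn -card_prod max_card orbT.
Qed.

(** Two elements whose first columns are proportional differ by an upper triangular element, whose
    top left entry is the ratio. There are [q.+1] directions and at most [q] elements per column. *)
Lemma card_diagonals A : A \subset SL F -> (forall x, x \in A -> x^-1%g \in A) ->
  #|A| <= q * q.+1 * #|diagonals A|.
Proof.
move=> AS AV; apply: leq_trans (card_columns AS) _.
rewrite -mulnA leq_mul2l; apply/orP; right; rewrite mulnC.
(* The projective line as [option F], with [None] for columns whose top entry is zero. *)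
pose slope (v : F * F) := if v.1 == 0%R then None else Some (v.2 / v.1)%R.
apply: leq_trans (card_le_fiber (f := slope) (k := #|diagonals A|) _) _; last first.
  by rewrite leq_mul2l -card_option max_card orbT.
move=> _ /imsetP[x xA ->]; set E := [set _ in _ | _].
have xS := subsetP AS _ xA; have /SLP dx := xS.
have [h1 h2 h3 h4] := SLV xS.
have key v : v \in E ->
    [/\ v.1 = (ed x * v.1 - eb x * v.2) * ea x & v.2 = (ed x * v.1 - eb x * v.2) * ec x]%R.
  move=> /setIdP[_]; case: v => a c; rewrite /slope /=.
  have [a0|a0] := eqVneq a 0%R; have [x0|x0] := eqVneq (ea x) 0%R => //.
    move=> _; split; first by rewrite x0 a0; ring.
    rewrite a0; move: dx; rewrite x0 => dx.
    by apply: (lincomb1 (- c) dx); ring.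
  move=> /eqP[e]; have cE : c = (a * (ec x / ea x))%R by rewrite -e; field.
  split.
    by apply: (lincomb1 (- a) dx); rewrite cE; field.
  have -> : ((ed x * a - eb x * c) * ec x = a * ec x / ea x * (ea x * ed x - eb x * ec x))%R.
    by rewrite cE; field.
  by rewrite dx cE; field.
have inj : {in E &, injective (fun v : F * F => ed x * v.1 - eb x * v.2)%R}.
  move=> [a c] [a' c'] /key/=[H1 H2] /key/=[H1' H2'] e.
  by congr (_, _); [rewrite H1 e -H1'|rewrite H2 e -H2'].
rewrite -(card_in_imset inj); apply/subset_leq_card/subsetP.
move=> _ /imsetP[v vE ->]; have [H1 H2] := key v vE.
have /setIdP[/imsetP[y yA ev] _] := vE; rewrite /diagonals inE; apply/andP; split.
  apply/eqP => v0; have /SLP := subsetP AS _ yA.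
  move: H1 H2; rewrite v0 !mul0r ev /= => -> -> /eqP.
  by rewrite mul0r mulr0 subr0 eq_sym oner_eq0.
apply/existsP; exists (x^-1 * y)%g; rewrite mem_mulg ?AV //= !entUL h1 h2 h3 h4.
move: H1 H2; rewrite ev /= => H1 H2.
apply/andP; split; apply/eqP; last by ring.
by apply: (lincomb2 (- ec x) (ea x) H1 H2); ring.
Qed.

Lemma upper_diag b t : b \in SL F -> ec b = 0%R ->
  (b * upper t * b^-1)%g = upper (ea b ^+ 2 * t)%R.
Proof.
move=> bS c0; have [h1 h2 h3 h4] := SLV bS; move/SLP: bS; rewrite c0 mulr0 subr0 => db.
apply: gl2P; rewrite !entUL ?h1 ?h2 ?h3 ?h4 ?c0.
- by apply: (lincomb1 1 db); ring.
- by ring.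
- by ring.
- by apply: (lincomb1 1 db); ring.
Qed.

(** Conjugation by a triangular element dilates the upper unipotents by a square, so the dilations
    available are the squares of [diagonals A]. The bound on [#|A|] is what
    [exists_large_dilate_sum] needs, with [q.+1 <= 2 * q]. *)
Lemma upper_covered A : A \subset SL F -> (forall x, x \in A -> x^-1%g \in A) ->
  4 * q ^ 8 < #|A| ^ 3 -> forall t, upper t \in (A ^+ 16)%g.
Proof.
move=> AS AV big t; have q0 : 0 < q by apply/card_gt0P; exists 0%R.
have AAV x : x \in (A * A)%g -> x^-1%g \in (A * A)%g.
  by move=> /mulsgP[y z yA zA ->]; rewrite invMg mem_mulg ?AV.
have AAS : (A * A)%g \subset SL F by rewrite mul_subG.
have cX := card_uppers AS AV; have cD := card_diagonals AS AV.
set X := uppers A in cX; set D := diagonals A in cD.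
pose D2 := [set (s ^+ 2)%R | s in D].
have cD2 : #|D| <= 2 * #|D2|.
  apply: card_le_fiber => s _; apply: card_le2 => x y z.
  move=> /setIdP[_ /eqP ex] /setIdP[_ /eqP ey] /setIdP[_ /eqP ez].
  move: ey ez => /eqP; rewrite -ex eqf_sqr => /orP[/eqP->|/eqP->]; first by rewrite eqxx.
  by move=> /eqP; rewrite eqf_sqr => /orP[/eqP->|/eqP->] //; rewrite eqxx.
have D20 d : d \in D2 -> d != 0%R.
  by move=> /imsetP[s + ->]; rewrite /D /diagonals inE sqrf_eq0 => /andP[].
have [|d dD2 Yq] := @exists_large_dilate_sum F X D2 D20.
  rewrite ltnNge; apply/negP => le; move: big; apply/negP; rewrite -leqNgt.
  apply: (@leq_trans ((#|X| * q ^ 2) ^ 2 * (q * q.+1 * (2 * #|D2|)))).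
    rewrite (expnS _ 2) mulnC; apply: leq_mul; first by rewrite leq_exp2r.
    by apply: leq_trans cD _; rewrite leq_mul2l cD2 orbT.
  rewrite (_ : _ * _ = 2 * q ^ 5 * q.+1 * (#|D2| * #|X| ^ 2)); last by ring.
  apply: leq_trans (leq_mul (leqnn _) le) _.
  apply: (@leq_trans (2 * q ^ 5 * (2 * q) * q ^ 2)); last by apply/eq_leq; ring.
  by rewrite leq_mul2r leq_mul2l; lia.
have YA (y : F) : y \in dilate_sum X d -> upper y \in (A ^+ 8)%g.
  move=> /imsetP[[u v] /setXP[/= uX vX] ->].
  case/imsetP: dD2 => s; rewrite /D /diagonals inE => /andP[_].
  move=> /existsP[b /and3P[bA /eqP cb /eqP <-]] ->.
  rewrite upperD -upper_diag ?(subsetP AAS) //.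
  (* Two factors from [A] for each of [upper u], [b], [upper v] and [b^-1]. *)
  rewrite (_ : 8 = (1 + 1) + ((1 + 1) + (1 + 1) + (1 + 1))) // !expgD !expg1.
  by rewrite !mem_mulg //; [move: uX|move: vX|apply: AAV]; rewrite ?inE.
set Y := dilate_sum X d in Yq YA.
(* [Y] has more than half of the field, so it meets [t - Y]. *)
have [y yY tyY] : exists2 y : F, y \in Y & (t - y)%R \in Y.
  pose f (y : F) : F := (t - y)%R; have injf : injective f by move=> y z /addrI/oppr_inj.
  have : Y :&: f @: Y != set0.
    rewrite -card_gt0 -(ltn_add2l #|Y :|: f @: Y|) addn0 cardsUI card_imset //.
    by apply: leq_ltn_trans (max_card _) _; rewrite addnn -mul2n.
  move=> /set0Pn[z /setIP[zY /imsetP[y yY ez]]]; exists y => //.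
  by rewrite -/(f y) -ez.
rewrite -(subrK y t) upperD (_ : 16 = 8 + 8) // expgD mem_mulg //; exact: YA.
Qed.

Lemma expg_set_conj A w n x : x \in ((A :^ w) ^+ n)%g -> (x ^ w^-1 \in A ^+ n)%g.
Proof.
elim: n x => [|n IHn] x; first by rewrite !expg0 => /set1P ->; rewrite conj1g set11.
rewrite !expgS => /mulsgP[y z yA zA ->]; rewrite conjMg mem_mulg ?IHn //.
by rewrite -mem_conjg.
Qed.

(** The conjugate of [A] by the Weyl element [w] satisfies the same hypotheses, which yields the
    lower unipotents; four unipotent factors of cost 16 make 64. *)
Theorem SL_covered A : A \subset SL F -> (forall x, x \in A -> x^-1%g \in A) ->
  4 * q ^ 8 < #|A| ^ 3 -> SL F \subset (A ^+ 64)%g.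
Proof.
move=> AS AV big; pose w : gT := (mkSL 0 1 (-1) 0)%R.
have detw : (0 * 0 - 1 * (-1) = 1 :> F)%R by ring.
have wS : w \in SL F by apply: mkSL_SL.
have [w1 w2 w3 w4] := mkSLE detw; have [v1 v2 v3 v4] := SLV wS.
have lowA t : lower t \in (A ^+ 16)%g.
  have -> : lower t = (upper (- t)%R ^ w^-1)%g.
    rewrite conjgE invgK.
    by apply: gl2P; rewrite !entUL ?v1 ?v2 ?v3 ?v4 ?w1 ?w2 ?w3 ?w4; ring.
  apply/expg_set_conj/upper_covered; rewrite ?cardJg //.
    by rewrite -(@conjGid _ (SL_group F) _ wS) conjSg.
  by move=> x; rewrite !mem_conjg conjVg; apply: AV.
have upA := upper_covered AS AV big.
apply/subsetP => x /SL_upper_lower[s1 [s2 [s3 [s4 ->]]]].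
by rewrite (_ : 64 = 16 + 16 + 16 + 16) // !expgD !mem_mulg.
Qed.

End LargeSets.

(** * Polynomial functions along unipotent families *)

Section PolyFun.
Variable F : finFieldType.
Local Notation q := #|F|.
Implicit Types (t : F) (n m : nat).
Local Open Scope ring_scope.

Definition poly_fun n (f : F -> F) :=
  exists2 P : {poly F}, (size P <= n.+1)%N & forall t, f t = P.[t].

Lemma poly_funD n (f1 f2 : F -> F) : poly_fun n f1 -> poly_fun n f2 ->
  poly_fun n (fun t => f1 t + f2 t).
Proof.
move=> [P1 s1 e1] [P2 s2 e2]; exists (P1 + P2); last by move=> t; rewrite hornerD e1 e2.
by apply: leq_trans (size_polyD _ _) _; rewrite geq_max s1.
Qed.

Lemma poly_funM n m (f1 f2 : F -> F) : poly_fun n f1 -> poly_fun m f2 ->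
  poly_fun (n + m) (fun t => f1 t * f2 t).
Proof.
move=> [P1 s1 e1] [P2 s2 e2]; exists (P1 * P2); last by move=> t; rewrite hornerM e1 e2.
by apply: leq_trans (size_polyMleq _ _) _; lia.
Qed.

Lemma poly_fun_cst n (a : F) : poly_fun n (fun=> a).
Proof.
exists a%:P; last by move=> t; rewrite hornerC.
by apply: leq_trans (size_polyC_leq1 _) _.
Qed.

Lemma poly_fun_affine n (a b : F) (f : F -> F) : (0 < n)%N ->
  (forall t, f t = a + b * t) -> poly_fun n f.
Proof.
move=> n0 fE; exists (a%:P + b *: 'X); last by move=> t; rewrite !hornerE fE.
apply: leq_trans (size_polyD _ _) _; rewrite geq_max.
rewrite (leq_trans (size_polyC_leq1 _)) //=.
by apply: leq_trans (size_scale_leq _ _) _; rewrite size_polyX.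
Qed.

Lemma card_poly_fun_roots n (f : F -> F) t0 : poly_fun n f -> f t0 != 0 ->
  (#|[set t : F | f t == 0%R]| <= n)%N.
Proof.
move=> [P sP fE] ft0; have P0 : P != 0.
  by apply: contra ft0 => /eqP P0; rewrite fE P0 horner0.
rewrite -ltnS; apply: leq_trans _ sP; rewrite cardE.
apply: max_poly_roots => //; last exact: enum_uniq.
by apply/allP => t; rewrite mem_enum inE fE.
Qed.

Lemma card_zeros_step n (X : finType) (phi : F -> X -> F) t0 :
  (forall x, poly_fun n (phi^~ x)) ->
  (#|[set v : F * X | phi v.1 v.2 == 0%R]| <=
    q * #|[set x | phi t0 x == 0%R]| + n * #|X|)%N.
Proof.
move=> phiP; rewrite -sum1_card (eq_bigl (fun v => true && (phi v.1 v.2 == 0))); last first.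
  by move=> v; rewrite inE.
rewrite -(pair_big_dep predT (fun t x => phi t x == 0) (fun _ _ => 1%N)) /=.
rewrite (exchange_big_dep predT) //=.
apply: (@leq_trans (\sum_(x : X) ((phi t0 x == 0%R) * q + n))).
  apply: leq_sum => x _; rewrite sum1dep_card.
  have [_|nz] := eqVneq (phi t0 x) 0; first by rewrite mul1n (leq_trans (max_card _)) ?leq_addr.
  by rewrite mul0n; apply: card_poly_fun_roots (phiP x) nz.
rewrite big_split /= -big_distrl /= sum_nat_const mulnC (mulnC n) leq_add2r leq_mul2l.
by apply/orP; right; rewrite -sum1dep_card [X in (_ <= X)%N]big_mkcond.
Qed.

End PolyFun.

(** * Counting zeros on the group *)

Section OneParameter.
Variable F : finFieldType.
Local Notation gT := (gl2 F).
Local Notation q := #|F|.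
Implicit Types (x y c g h : gT) (f : gT -> F) (M : gT -> gT) (t : F) (n m : nat).
Local Open Scope ring_scope.

(** A substitute for the degree of a function on the group: it only looks along unipotent families,
    three of which parametrize the big cell. *)
Definition one_param n f := forall x y,
  poly_fun n (fun t => f (x * upper t * y)%g) /\ poly_fun n (fun t => f (x * lower t * y)%g).

Lemma one_paramD n f1 f2 : one_param n f1 -> one_param n f2 ->
  one_param n (fun x => f1 x + f2 x).
Proof. by move=> H1 H2 x y; case: (H1 x y) (H2 x y) => ? ? [? ?]; split; apply: poly_funD. Qed.

Lemma one_paramM n m f1 f2 : one_param n f1 -> one_param m f2 ->
  one_param (n + m) (fun x => f1 x * f2 x).
Proof. by move=> H1 H2 x y; case: (H1 x y) (H2 x y) => ? ? [? ?]; split; apply: poly_funM. Qed.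

Lemma one_param_cst n (a : F) : one_param n (fun=> a).
Proof. by move=> x y; split; apply: poly_fun_cst. Qed.

Lemma one_paramN n f : one_param n f -> one_param n (fun x => - f x).
Proof.
move=> Hf; have := one_paramM (one_param_cst 0 (-1)) Hf; rewrite add0n => H x y.
by case: (H x y) => -[P s e] [Q s' e']; split;
  [exists P|exists Q] => // t; rewrite -?e -?e' mulN1r.
Qed.

Lemma one_paramB n f1 f2 : one_param n f1 -> one_param n f2 ->
  one_param n (fun x => f1 x - f2 x).
Proof. by move=> H1 H2; apply: one_paramD => //; apply: one_paramN. Qed.

Definition one_param_mx n M := [/\ one_param n (fun x => ea (M x)),
  one_param n (fun x => eb (M x)), one_param n (fun x => ec (M x))
  & one_param n (fun x => ed (M x))].

Lemma one_param_ext n f1 f2 : f1 =1 f2 -> one_param n f1 -> one_param n f2.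
Proof.
move=> e H x y; case: (H x y) => -[P s eP] [Q s' eQ]; split.
  by exists P => // t; rewrite -eP e.
by exists Q => // t; rewrite -eQ e.
Qed.

Lemma one_param_mx_ext n M1 M2 : M1 =1 M2 -> one_param_mx n M1 -> one_param_mx n M2.
Proof.
move=> e [A B C D]; split; [apply: one_param_ext A|apply: one_param_ext B
  |apply: one_param_ext C|apply: one_param_ext D] => x; by rewrite e.
Qed.

Lemma one_param_mx_id : one_param_mx 1 id.
Proof.
split=> x y; split;
  [ apply: (@poly_fun_affine F _ (ea (x * y)%g) (ea x * ec y))
  | apply: (@poly_fun_affine F _ (ea (x * y)%g) (eb x * ea y))
  | apply: (@poly_fun_affine F _ (eb (x * y)%g) (ea x * ed y))
  | apply: (@poly_fun_affine F _ (eb (x * y)%g) (eb x * eb y))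
  | apply: (@poly_fun_affine F _ (ec (x * y)%g) (ec x * ec y))
  | apply: (@poly_fun_affine F _ (ec (x * y)%g) (ed x * ea y))
  | apply: (@poly_fun_affine F _ (ed (x * y)%g) (ec x * ed y))
  | apply: (@poly_fun_affine F _ (ed (x * y)%g) (ed x * eb y)) ] => // t;
  by rewrite !entUL; ring.
Qed.

Lemma one_param_mx_cst n c : one_param_mx n (fun=> c).
Proof. by split; apply: one_param_cst. Qed.

Lemma one_param_mxM n m M1 M2 : one_param_mx n M1 -> one_param_mx m M2 ->
  one_param_mx (n + m) (fun x => M1 x * M2 x)%g.
Proof.
move=> [a1 b1 c1 d1] [a2 b2 c2 d2]; split.
- by apply: one_param_ext (one_paramD (one_paramM a1 a2) (one_paramM b1 c2)) => x;
    rewrite entM.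
- by apply: one_param_ext (one_paramD (one_paramM a1 b2) (one_paramM b1 d2)) => x;
    rewrite entM.
- by apply: one_param_ext (one_paramD (one_paramM c1 a2) (one_paramM d1 c2)) => x;
    rewrite entM.
- by apply: one_param_ext (one_paramD (one_paramM c1 b2) (one_paramM d1 d2)) => x;
    rewrite entM.
Qed.

(** On the big cell, Schwartz-Zippel in three coordinates, with the origin going to the identity,
    gives [3 * n * q ^ 2]; the triangular matrices add at most [q ^ 2]. *)
Let card_zeros1 n f : one_param n f -> f 1%g != 0 ->
  (#|[set x in SL F | f x == 0%R]| <= (3 * n + 1) * q ^ 2)%N.
Proof.
move=> fP f1.
pose phi (s : F) (v : F * F) := f (upper s * lower v.1 * upper v.2)%g.
pose Z := [set u : F * (F * F) | phi u.1 u.2 == 0].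
have cZ : (#|Z| <= 3 * n * q ^ 2)%N.
  apply: leq_trans (@card_zeros_step F n _ phi 0 _) _.
    by move=> v; have [+ _] := fP 1%g (lower v.1 * upper v.2)%g;
      move=> [P sP eP]; exists P => // t; rewrite -eP mul1g mulgA.
  pose phi2 (s t : F) := f (lower s * upper t)%g.
  have -> : [set v | phi 0 v == 0] = [set v | phi2 v.1 v.2 == 0].
    by apply/setP => v; rewrite !inE /phi upper0 mul1g.
  have H2 : (#|[set v | phi2 v.1 v.2 == 0%R]| <= q * n + n * q)%N.
    apply: leq_trans (@card_zeros_step F n _ phi2 0 _) _.
      by move=> t; have [_ +] := fP 1%g (upper t); move=> [P sP eP];
        exists P => // s; rewrite -eP mul1g.
    rewrite leq_add2r leq_mul2l; apply/orP; right.
    apply: (@card_poly_fun_roots F n (phi2 0) 0); last by rewrite /phi2 lower0 upper0 mulg1.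
    by have [+ _] := fP 1%g 1%g; move=> [P sP eP];
      exists P => // s; rewrite -eP mul1g mulg1 /phi2 lower0 mul1g.
  rewrite card_prod; apply: leq_trans (leq_add (leq_mul (leqnn q) H2) (leqnn _)) _.
  by apply/eq_leq; ring.
rewrite -(cardsID [set x | ec x == 0] [set x in SL F | f x == 0]) addnC mulnDl leq_add //.
  apply: leq_trans _ cZ.
  pose psi x := ((ea x - 1) / ec x, (ec x, (ed x - 1) / ec x)).
  have psiK x : x \in SL F -> ec x != 0 ->
      x = (upper (psi x).1 * lower (psi x).2.1 * upper (psi x).2.2)%g.
    by move=> xS c0; apply: SL_bruhat.
  set E := _ :\: _; have inj : {in E &, injective psi}.
    move=> x y /setDP[/setIdP[xS _] xc] /setDP[/setIdP[yS _] yc] e.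
    by rewrite inE in xc; rewrite inE in yc; rewrite (psiK x) // e -psiK.
  rewrite -(card_in_imset inj); apply/subset_leq_card/subsetP.
  move=> _ /imsetP[x /setDP[/setIdP[xS fx] xc] ->]; rewrite inE in xc.
  by rewrite inE /phi -psiK.
rewrite mul1n; apply: leq_trans (card_columns _) _.
  by apply/subsetP => x /setIP[/setIdP[]].
rewrite -mulnn leq_mul2l; apply/orP; right.
apply: (@leq_trans #|[set ((a, 0) : F * F) | a in [set: F]]|); last first.
  by apply: leq_trans (leq_imset_card _ _) _; rewrite cardsT.
apply/subset_leq_card/subsetP => _ /imsetP[x /setIP[_ xc] ->].
by move: xc; rewrite inE => /eqP ->; apply: imset_f.
Qed.

Lemma card_zeros n f c : one_param n f -> c \in SL F -> f c != 0 ->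
  (#|[set x in SL F | f x == 0%R]| <= (3 * n + 1) * q ^ 2)%N.
Proof.
move=> fP cS fc; have fcP : one_param n (fun x => f (c * x)%g).
  by move=> x y; have [[P s e] [Q s' e']] := fP (c * x)%g y; split;
    [exists P|exists Q] => // t; rewrite -?e -?e' !mulgA.
have := card_zeros1 fcP; rewrite mulg1 => /(_ fc); apply: leq_trans.
rewrite -(card_imset _ (mulgI c^-1%g)); apply/subset_leq_card/subsetP.
move=> _ /imsetP[x /setIdP[xS fx] ->].
by rewrite inE mulKVg fx groupM ?groupV.
Qed.

Lemma card_zeros2 n (f : gT -> gT -> F) g0 h0 :
  (forall h, one_param n (f^~ h)) -> (forall g, one_param n (f g)) ->
  g0 \in SL F -> h0 \in SL F -> f g0 h0 != 0 ->
  (#|[set v in setX (SL F) (SL F) | f v.1 v.2 == 0%R]| <= (6 * n + 2) * q ^ 5)%N.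
Proof.
move=> fP1 fP2 g0S h0S f0.
pose E1 := setX [set g in SL F | f g h0 == 0] (SL F).
pose E := [set v in setX (SL F) (SL F) | f v.1 v.2 == 0].
rewrite -(cardsID E1 E) (_ : (6 * n + 2) * q ^ 5 = (3 * n + 1) * q ^ 2 * q ^ 3
  + q ^ 3 * ((3 * n + 1) * q ^ 2))%N; last by ring.
apply: leq_add.
  apply: (@leq_trans #|E1|); first by apply/subset_leq_card/subsetIr.
  rewrite cardsX leq_mul ?card_SL_le //.
  exact: (card_zeros (fP1 h0) g0S f0).
rewrite -sum1_card (partition_big fst (mem (SL F))) /=; last first.
  by move=> [g h] /setDP[/setIdP[/setXP[]]].
apply: (@leq_trans (\sum_(g in SL F) (3 * n + 1) * q ^ 2)); last first.
  by rewrite sum_nat_const leq_mul2r card_SL_le orbT.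
apply: leq_sum => g gS; rewrite sum1dep_card.
have [e0|nz] := eqVneq (f g h0) 0.
  rewrite eq_card0 // => -[g1 h]; apply/negP => /setIdP[/setDP[/setIdP[gh _] n1] /eqP/= eg].
  case/negP: n1; move: gh; rewrite eg => /setXP[/= _ hS].
  by apply/setXP; split=> //; apply/setIdP; rewrite e0.
apply: leq_trans (card_zeros (fP2 g) h0S nz).
have inj : {in [set v in E :\: E1 | v.1 == g] &, injective snd}.
  move=> [g1 h1] [g2 h2] /setIdP[_ /eqP/= e1] /setIdP[_ /eqP/= e2] /= e3.
  by rewrite e1 e2 e3.
rewrite -(card_in_imset inj); apply/subset_leq_card/subsetP.
move=> _ /imsetP[[g1 h1] /setIdP[/setDP[/setIdP[/setXP[/= _ hS] fz] _] /eqP /= eg] ->].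
by rewrite inE hS -eg.
Qed.

End OneParameter.

(** * Coincidences between words *)

Section Words.
Variables (gT : finGroupType).
Implicit Types (g h : gT) (w : seq bool).

Definition word_eval g h w : gT := (\prod_(b <- w) (if b then g else h))%g.

Lemma word_eval_cons g h b w :
  word_eval g h (b :: w) = ((if b then g else h) * word_eval g h w)%g.
Proof. exact: big_cons. Qed.

Lemma word_eval_ball g h w : word_eval g h w \in word_ball [set g; h] (size w).
Proof.
elim: w => [|b w IHw]; first by rewrite /word_eval big_nil mem_ball1.
rewrite word_eval_cons /= -add1n; apply: ball_mul IHw.
by apply: gen_sub_ball => //; case: b; rewrite !inE eqxx ?orbT.
Qed.

End Words.

(* The action of a word on the column vector (1, 1), with true and false acting as
   the elementary matrices [upper 1] and [lower 1]. *)
Fixpoint word_vec (w : seq bool) : nat * nat :=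
  if w is b :: w' then
    let v := word_vec w' in if b then (v.1 + v.2, v.2) else (v.1, v.1 + v.2)
  else (1, 1).

Lemma word_vec_gt0 w : 0 < (word_vec w).1 /\ 0 < (word_vec w).2.
Proof. by elim: w => [|[] w [H1 H2]] //=; split=> //; rewrite addn_gt0 H1. Qed.

Lemma word_vec_le w : (word_vec w).1 <= 2 ^ size w /\ (word_vec w).2 <= 2 ^ size w.
Proof. by elim: w => [|[] w [H1 H2]] //=; rewrite expnS; split; lia. Qed.

(** Euclid's algorithm: both coordinates are positive, so the larger one reveals the first letter,
    and subtraction recovers the rest. *)
Lemma word_vec_inj w w' : size w = size w' -> word_vec w = word_vec w' -> w = w'.
Proof.
elim: w w' => [|b w IHw] [|b' w'] //= [sw].
have [p1 p2] := word_vec_gt0 w; have [p1' p2'] := word_vec_gt0 w'.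
move: (IHw w' sw); case: (word_vec w) (word_vec w') p1 p2 p1' p2' => [x y] [x' y'] /=.
by case: b b' => [] [] /= p1 p2 p1' p2' H [e1 e2]; try lia; rewrite H //;
   congr (_, _); lia.
Qed.

Section BadPairs.
Variables (F : finFieldType) (p : nat).
Hypotheses (pF : p \in [pchar F]%R).
Local Notation gT := (gl2 F).
Local Notation q := #|F|.
Implicit Types (x y g h : gT) (w : seq bool) (n : nat).
Local Open Scope ring_scope.

Lemma natr_inj_small (a b : nat) : (a < p)%N -> (b < p)%N -> a%:R = b%:R :> F -> a = b.
Proof.
wlog le_ab : a b / (a <= b)%N => [H ap bp e|].
  by case/orP: (leq_total a b) => le; [|symmetry]; apply: H.
move=> ap bp /esym/eqP; rewrite -subr_eq0 -natrB // -(dvdn_pcharf pF) => d.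
apply/eqP; rewrite eqn_leq le_ab /= -subn_eq0; apply/eqP.
have [//|pos] := posnP (b - a)%N; have := dvdn_leq pos d.
by rewrite leqNgt (leq_ltn_trans (leq_subr a b) bp).
Qed.

Lemma word_eval_vec w : let M := word_eval (upper 1%R : gT) (lower 1%R) w in
  ea M + eb M = (word_vec w).1%:R /\ ec M + ed M = (word_vec w).2%:R.
Proof.
elim: w => [|b w [IH1 IH2]] /=; first by rewrite /word_eval big_nil !entM addr0 add0r.
rewrite word_eval_cons; set M := word_eval _ _ w in IH1 IH2 *.
case: b; rewrite !entUL /= natrD -IH1 -IH2; split; ring.
Qed.

(** The vectors of both words have coordinates at most [2 ^ size w], so below [p] they can be read
    off from their residues. *)
Lemma word_eval_neq w w' : size w = size w' -> (2 ^ size w < p)%N -> w != w' ->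
  word_eval (upper 1%R : gT) (lower 1%R) w != word_eval (upper 1%R) (lower 1%R) w'.
Proof.
move=> sw wp; apply: contra => /eqP e; apply/eqP/(word_vec_inj sw).
have [H1 H2] := word_eval_vec w; have [H1' H2'] := word_eval_vec w'.
have [l1 l2] := word_vec_le w; have [l1' l2'] := word_vec_le w'.
rewrite -sw in l1' l2'; move: H1 H2; rewrite e H1' H2' => E1 E2.
have := natr_inj_small (leq_ltn_trans l1' wp) (leq_ltn_trans l1 wp) E1.
have := natr_inj_small (leq_ltn_trans l2' wp) (leq_ltn_trans l2 wp) E2.
by case: (word_vec w) (word_vec w') => ? ? [? ?] /= -> ->.
Qed.

Lemma one_param_mx_word1 h w : one_param_mx (size w) (fun g : gT => word_eval g h w).
Proof.
elim: w => [|b w IHw].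
  by apply: one_param_mx_ext (@one_param_mx_cst F 0 1%g) => x; rewrite /word_eval big_nil.
have H1 : one_param_mx 1 (fun g : gT => if b then g else h).
  by case: b; [apply: one_param_mx_id|apply: one_param_mx_cst].
by apply: one_param_mx_ext (one_param_mxM H1 IHw) => x; rewrite word_eval_cons.
Qed.

Lemma one_param_mx_word2 g w : one_param_mx (size w) (fun h : gT => word_eval g h w).
Proof.
elim: w => [|b w IHw].
  by apply: one_param_mx_ext (@one_param_mx_cst F 0 1%g) => x; rewrite /word_eval big_nil.
have H1 : one_param_mx 1 (fun h : gT => if b then g else h).
  by case: b; [apply: one_param_mx_cst|apply: one_param_mx_id].
by apply: one_param_mx_ext (one_param_mxM H1 IHw) => x; rewrite word_eval_cons.
Qed.

(** Some entry of the two words differs at the elementary pair; the difference of these entries is a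
    function of degree at most [size w] in each variable that is not identically zero. *)
Lemma card_word_coincidence w w' : size w = size w' -> (2 ^ size w < p)%N -> w != w' ->
  (#|[set v in setX (SL F) (SL F) | word_eval v.1 v.2 w == word_eval v.1 v.2 w']|
    <= (6 * size w + 2) * q ^ 5)%N.
Proof.
move=> sw wp ww'; have neq := word_eval_neq sw wp ww'.
have [e [He1 He2 eUL eP]] : exists e : gT -> F, [/\
    forall h w, one_param (size w) (fun g => e (word_eval g h w)),
    forall g w, one_param (size w) (fun h => e (word_eval g h w)),
    e (word_eval (upper 1%R) (lower 1%R) w) != e (word_eval (upper 1%R) (lower 1%R) w')
  & forall x y, x = y -> e x = e y].
  have : ~~ [&& ea (word_eval (upper 1 : gT) (lower 1) w) == ea (word_eval (upper 1) (lower 1) w'),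
      eb (word_eval (upper 1 : gT) (lower 1) w) == eb (word_eval (upper 1) (lower 1) w'),
      ec (word_eval (upper 1 : gT) (lower 1) w) == ec (word_eval (upper 1) (lower 1) w')
    & ed (word_eval (upper 1 : gT) (lower 1) w) == ed (word_eval (upper 1) (lower 1) w')].
    apply: contra neq => /and4P[/eqP h1 /eqP h2 /eqP h3 /eqP h4].
    by apply/eqP; apply: gl2P.
  rewrite !negb_and => /or4P[] ne;
    [exists (@ea F)|exists (@eb F)|exists (@ec F)|exists (@ed F)]; split=> //;
    try (by move=> ? ? ->); move=> u v;
    by case: (one_param_mx_word1 u v); case: (one_param_mx_word2 u v).
pose f g h : F := e (word_eval g h w) - e (word_eval g h w').
have := @card_zeros2 F (size w) f (upper 1) (lower 1).
rewrite upper_SL lower_SL /f subr_eq0 eUL => H; apply: leq_trans (H _ _ _ _ _) => //.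
- apply/subset_leq_card/subsetP => v /setIdP[vS /eqP ev].
  by apply/setIdP; split=> //; rewrite ev subrr eqxx.
- by move=> h; apply: one_paramB; [|rewrite sw]; apply: He1.
- by move=> g; apply: one_paramB; [|rewrite sw]; apply: He2.
Qed.

Definition bad_pairs n : {set gT * gT} := [set v in setX (SL F) (SL F) |
  (commdet v.1 v.2 == 0) ||
  [exists ww : n.-tuple bool * n.-tuple bool, (ww.1 != ww.2) &&
    (word_eval v.1 v.2 ww.1 == word_eval v.1 v.2 ww.2)]].

Lemma card_commdet0 :
  (#|[set v in setX (SL F) (SL F) | commdet v.1 v.2 == 0%R]| <= 14 * q ^ 5)%N.
Proof.
have [A B C D] := @one_param_mx_id F.
have P h : [/\ one_param 1 (fun g => comm11 g h), one_param 1 (fun g => comm12 g h)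
    & one_param 1 (fun g => comm21 g h)].
  split; rewrite /comm11 /comm12 /comm21.
  - by apply: one_paramB; [apply: (one_paramM (n := 1) (m := 0))|
      apply: (one_paramM (n := 0) (m := 1))] => //; apply: one_param_cst.
  - by apply: one_paramB; [apply: (one_paramM (n := 0) (m := 1))|
      apply: (one_paramM (n := 1) (m := 0))] => //; try apply: one_param_cst; apply: one_paramB.
  - by apply: one_paramB; [apply: (one_paramM (n := 1) (m := 0))|
      apply: (one_paramM (n := 0) (m := 1))] => //; try apply: one_param_cst; apply: one_paramB.
have Q g : [/\ one_param 1 (comm11 g), one_param 1 (comm12 g) & one_param 1 (comm21 g)].
  split; rewrite /comm11 /comm12 /comm21.
  - by apply: one_paramB; [apply: (one_paramM (n := 0) (m := 1))|
      apply: (one_paramM (n := 1) (m := 0))] => //; apply: one_param_cst.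
  - by apply: one_paramB; [apply: (one_paramM (n := 1) (m := 0))|
      apply: (one_paramM (n := 0) (m := 1))] => //; try apply: one_param_cst; apply: one_paramB.
  - by apply: one_paramB; [apply: (one_paramM (n := 0) (m := 1))|
      apply: (one_paramM (n := 1) (m := 0))] => //; try apply: one_param_cst; apply: one_paramB.
(* The degree is two in each variable, whence [14 = 6 * 2 + 2]; the value at the elementary pair is
   1. *)
apply: (@card_zeros2 F 2 (fun g h => commdet g h) (upper 1) (lower 1)).
- by move=> h; have [P1 P2 P3] := P h; apply: one_paramD; apply: (one_paramM (n := 1) (m := 1)).
- by move=> g; have [P1 P2 P3] := Q g; apply: one_paramD; apply: (one_paramM (n := 1) (m := 1)).
- exact: upper_SL.
- exact: lower_SL.
- rewrite /commdet /comm11 /comm12 /comm21 !entUL (_ : _ + _ = 1) ?oner_neq0 //; ring.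
Qed.

Lemma card_bad_pairs n : (2 ^ n < p)%N ->
  (#|bad_pairs n| <= (4 ^ n * (6 * n + 2) + 14) * q ^ 5)%N.
Proof.
move=> np; pose E0 := [set v in setX (SL F) (SL F) | commdet v.1 v.2 == 0].
pose E (ww : n.-tuple bool * n.-tuple bool) := [set v in setX (SL F) (SL F) |
  word_eval v.1 v.2 ww.1 == word_eval v.1 v.2 ww.2].
have sub : bad_pairs n \subset E0 :|: \bigcup_(ww | ww.1 != ww.2) E ww.
  apply/subsetP => v /setIdP[vS /orP[c0|/existsP[ww /andP[ne e]]]].
    by apply/setUP; left; apply/setIdP.
  by apply/setUP; right; apply/bigcupP; exists ww => //; apply/setIdP.
apply: leq_trans (subset_leq_card sub) _; apply: leq_trans (leq_card_setU _ _) _.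
rewrite addnC mulnDl leq_add ?card_commdet0 //.
apply: (@leq_trans (\sum_(ww : n.-tuple bool * n.-tuple bool | ww.1 != ww.2) #|E ww|)).
  elim/big_rec2: _ => [|ww m A _ IH]; first by rewrite cards0.
  by apply: leq_trans (leq_card_setU _ _) _; rewrite leq_add2l.
apply: (@leq_trans (\sum_(ww : n.-tuple bool * n.-tuple bool) (6 * n + 2) * q ^ 5)).
  rewrite [X in (_ <= X)%N](bigID (fun ww => ww.1 != ww.2)) /=.
  apply: leq_trans (leq_addr _ _); apply: leq_sum => -[w w'] /= ne.
  have := @card_word_coincidence w w'; rewrite !size_tuple => H.
  by apply: H.
by rewrite sum_nat_const card_prod !card_tuple card_bool -expnMn mulnA.
Qed.

Lemma good_pair_ball n g h : g \in SL F -> h \in SL F -> (g, h) \notin bad_pairs n ->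
  commdet g h != 0 /\ (2 ^ n <= #|word_ball [set g; h] n|)%N.
Proof.
move=> gS hS; rewrite inE negb_and; case/orP.
  by case/negP; apply/setXP.
rewrite negb_or => /andP[/= c0 /existsPn H]; split=> //.
have inj : injective (fun w : n.-tuple bool => word_eval g h w).
  move=> w w' e; apply/eqP; have := H (w, w'); rewrite /= negb_and negbK.
  by case/orP => //; rewrite e eqxx.
rewrite -card_bool -card_tuple -(card_imset _ inj); apply/subset_leq_card/subsetP.
by move=> _ /imsetP[w _ ->]; rewrite -{2}(size_tuple w) word_eval_ball.
Qed.

End BadPairs.

(** * Counting generating pairs *)

Section Generation.
Variables (F : finFieldType) (p : nat).
Hypotheses (pF : p \in [pchar F]%R) (cF : #|F| = p).
Local Notation gT := (gl2 F).
Implicit Types (x y g h : gT) (s t : F) (n i I : nat).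
Local Open Scope ring_scope.

Lemma natr_surj (a : F) : exists n : nat, a = n%:R.
Proof.
pose f (i : 'I_p) : F := (i : nat)%:R.
have inj : injective f by move=> i j e; apply/val_inj/(natr_inj_small pF _ _ e).
have : a \in f @: [set: 'I_p].
  rewrite (_ : f @: _ = [set: F]) ?inE //.
  by apply/eqP; rewrite eqEcard subsetT card_imset // !cardsT cF card_ord leqnn.
by move=> /imsetP[i _ ->]; exists i.
Qed.

Lemma lowerX t n : (lower t ^+ n)%g = lower (t *+ n).
Proof. by elim: n => [|n IHn]; rewrite ?expg0 ?lower0 // expgS mulrS lowerD IHn. Qed.

Lemma upperX t n : (upper t ^+ n)%g = upper (t *+ n).
Proof. by elim: n => [|n IHn]; rewrite ?expg0 ?upper0 // expgS mulrS upperD IHn. Qed.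

(* With d = 0 after a left shear, g conjugates the lower unipotents to the upper ones. *)
Lemma lower_generates (H : {group gT}) g t : g \in SL F -> g \in H ->
  t != 0 -> lower t \in H -> eb g != 0 -> SL F \subset H.
Proof.
move=> gS gH t0 tH b0.
have lowH s : lower s \in H.
  have [n en] := natr_surj (s / t).
  have -> : s = t *+ n by rewrite -mulr_natr -en; field.
  by rewrite -lowerX groupX.
pose m := (lower (- ed g / eb g) * g)%g.
have mH : m \in H by rewrite groupM.
have mS : m \in SL F by rewrite groupM ?lower_SL.
have md : ed m = 0 by rewrite /m !entUL; field.
have mb : eb m = eb g by rewrite /m !entUL; ring.
clearbody m; have [v1 v2 v3 v4] := SLV mS; have /SLP := mS.
rewrite md mb mulr0 sub0r => det.
have upH s : upper s \in H.
  have -> : upper s = (m * lower (- s / eb g ^+ 2) * m^-1)%g.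
    apply: gl2P; rewrite !entUL ?v1 ?v2 ?v3 ?v4 ?md ?mb.
    - by apply: (lincomb1 (-1) det); ring.
    - by field.
    - by ring.
    - by apply: (lincomb1 (-1) det); ring.
  by rewrite !groupM ?groupV.
apply/subsetP => x /SL_upper_lower[s1 [s2 [s3 [s4 ->]]]].
by rewrite !groupM.
Qed.

(** The unipotents fixing the column vector [(s, 1)]. *)
Definition lowerJ s t : gT := (upper s * lower t * upper (- s))%g.

Lemma lowerJ_SL s t : lowerJ s t \in SL F.
Proof. by rewrite !groupM ?upper_SL ?lower_SL. Qed.

Lemma tr_lowerJ s t : tr (lowerJ s t) = 2.
Proof. by rewrite /tr !entUL; ring. Qed.

Lemma lowerJ_inj s t s' t' : t != 0 -> lowerJ s t = lowerJ s' t' -> (s, t) = (s', t').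
Proof.
move=> t0 e; have := congr1 (@ec F) e; have := congr1 (@ea F) e.
rewrite !entUL => E1 E2.
have tt : t = t' by apply: (lincomb1 1 E2); ring.
congr (_, _) => //; apply: (mulfI t0); rewrite -tt in E1.
by apply: (lincomb1 1 E1); ring.
Qed.

(** The group contains [g], hence [lowerJ s t]. Conjugation by [upper s] turns the latter into
    [lower t], and the condition on [eb] says that [g] moves the line fixed by the unipotent. *)
Lemma lowerJ_generates g s t : g \in SL F -> t != 0 -> eb (g ^ upper s)%g != 0 ->
  forall i, <<[set g; (g ^+ i * lowerJ s t)%g]>>%g = SL F.
Proof.
move=> gS t0 b0 i; apply/eqP; rewrite eqEsubset; apply/andP; split.
  rewrite (@gen_subG _ _ (SL_group F)); apply/subsetP => x /set2P[]-> //.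
  by rewrite groupM ?groupX ?lowerJ_SL.
set K := <<_>>%g; have gK : g \in K by rewrite mem_gen // !inE eqxx.
have vK : lowerJ s t \in K.
  by rewrite -(mulKg (g ^+ i)%g (lowerJ s t)) groupM ?groupV ?groupX // mem_gen // !inE eqxx orbT.
have : SL F \subset (K :^ upper s)%G.
  apply: (@lower_generates _ (g ^ upper s)%g t) => //.
  - by rewrite groupJ ?upper_SL.
  - by rewrite memJ_conjg.
  rewrite (_ : lower t = (lowerJ s t ^ upper s)%g) ?memJ_conjg //.
  by rewrite conjgE /lowerJ upperN !mulgA mulVg mul1g mulgKV.
by rewrite -{1}(@conjGid _ (SL_group F) _ (upper_SL s)) conjSg.
Qed.

(** The entry is a polynomial of degree at most two in [s], nonzero because [g] is not scalar; its
    roots are the lines spanned by [(s, 1)] that [g] fixes. *)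
Lemma card_fixed_shear g : g \in SL F -> regular g ->
  (#|[set s : F | eb (g ^ upper s)%g == 0%R]| <= 2)%N.
Proof.
move=> gS rg; pose P : {poly F} := (eb g)%:P + (ea g - ed g) *: 'X - ec g *: 'X^2.
have eP s : eb (g ^ upper s)%g = P.[s].
  rewrite conjgE -upperN !entUL /P !(hornerD, hornerN, hornerZ, hornerC, hornerX, hornerXn).
  by ring.
have P0 : P != 0.
  apply: contra (regular_nonscalar gS rg) => /eqP P0.
  have := congr1 (fun R : {poly F} => R`_0) P0; have := congr1 (fun R : {poly F} => R`_1) P0.
  have := congr1 (fun R : {poly F} => R`_2) P0.
  rewrite /P !coefE /= !(mulr0, mulr1, addr0, add0r, subr0) => /eqP + /eqP + /eqP.
  by rewrite oppr_eq0 subr_eq0 => -> -> ->.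
have sP : (size P <= 3)%N.
  rewrite /P; apply: leq_trans (size_polyD _ _) _; rewrite geq_max size_polyN.
  rewrite (leq_trans (size_scale_leq _ _)) ?size_polyXn // andbT.
  apply: leq_trans (size_polyD _ _) _; rewrite geq_max (leq_trans (size_polyC_leq1 _)) //=.
  by rewrite (leq_trans (size_scale_leq _ _)) // size_polyX.
rewrite -ltnS; apply: leq_trans _ sP; rewrite cardE.
apply: max_poly_roots => //; last exact: enum_uniq.
by apply/allP => s; rewrite mem_enum inE eP.
Qed.

Definition long_order I : {set gT} :=
  [set g in SL F | regular g & [forall i : 'I_I, (0 < i)%N ==> (g ^+ i != 1)%g]].

Lemma one_param_mxX n : one_param_mx n (fun g : gT => g ^+ n)%g.
Proof.
elim: n => [|n IHn].
  by apply: one_param_mx_ext (@one_param_mx_cst F 0 1%g) => x; rewrite expg0.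
by apply: one_param_mx_ext (one_param_mxM (@one_param_mx_id F) IHn) => x; rewrite expgS.
Qed.

Lemma card_nonregular : (5 < p)%N ->
  (#|[set g in SL F | ~~ regular g]| <= 7 * p ^ 2)%N.
Proof.
move=> p5; have [A _ _ D] := @one_param_mx_id F.
pose f g : F := tr g * tr g + - 4.
have fP : one_param 2 f.
  apply: one_paramD; last exact: one_param_cst.
  by apply: (one_paramM (n := 1) (m := 1)); apply: one_paramD.
(* The test point has trace 3, so the discriminant there is 5, nonzero for [p > 5]. *)
have := @card_zeros F 2 f (upper 1 * lower 1)%g fP.
rewrite groupM ?upper_SL ?lower_SL // cF => H.
apply: leq_trans (H isT _).
  apply/subset_leq_card/subsetP => g /setIdP[gS]; rewrite /regular negbK => /eqP e.
  by apply/setIdP; split=> //; rewrite /f -expr2 e subrr eqxx.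
rewrite /f /tr !entUL (_ : _ + _ = 5%:R); last by ring.
by rewrite -(dvdn_pcharf pF) gtnNdvd.
Qed.

(** The upper right entry of [g ^+ i] has degree at most [i] and takes the nonzero value [i] at
    [upper 1]. *)
Lemma card_short_order i : (0 < i < p)%N ->
  (#|[set g in SL F | (g ^+ i == 1)%g]| <= (3 * i + 1) * p ^ 2)%N.
Proof.
move=> /andP[i0 ip]; have [_ B _ _] := one_param_mxX i.
have := @card_zeros F i _ (upper 1) B (upper_SL 1).
rewrite upperX eb_upper -(dvdn_pcharf pF) gtnNdvd // cF => /(_ isT).
apply: leq_trans; apply/subset_leq_card/subsetP => g /setIdP[gS /eqP e].
by apply/setIdP; rewrite e eb1.
Qed.

Lemma card_long_order I : (5 < p)%N -> (0 < I)%N -> (4 * (7 + 3 * I ^ 2) <= p)%N ->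
  (p ^ 3 <= 4 * #|long_order I|)%N.
Proof.
move=> p5 I0 Ip; have cSL := card_SL_ge F; rewrite cF in cSL.
have sub : SL F \subset long_order I :|: ([set g in SL F | ~~ regular g] :|:
    \bigcup_(i < I | (0 < i)%N) [set g in SL F | (g ^+ i == 1)%g]).
  apply/subsetP => g gS; apply/setUP.
  have [rg|nrg] := boolP (regular g); last by right; apply/setUP; left; apply/setIdP.
  have [gord|] := boolP [forall i : 'I_I, (0 < i)%N ==> (g ^+ i != 1)%g].
    by left; apply/setIdP; rewrite rg.
  move=> /forallPn[i]; rewrite negb_imply negbK => /andP[i0 e].
  by right; apply/setUP; right; apply/bigcupP; exists i => //; apply/setIdP.
have IleP : (I < p)%N by apply: leq_trans Ip; clear; nia.
have short : (#|\bigcup_(i < I | (0 < i)%N) [set g in SL F | (g ^+ i == 1)%g]|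
    <= 3 * I ^ 2 * p ^ 2)%N.
  apply: (@leq_trans (\sum_(i < I | (0 < i)%N) #|[set g in SL F | (g ^+ i == 1)%g]|)).
    elim/big_rec2: _ => [|i m A _ IH]; first by rewrite cards0.
    by apply: leq_trans (leq_card_setU _ _) _; rewrite leq_add2l.
  apply: (@leq_trans (\sum_(i < I) 3 * I * p ^ 2)); last first.
    by rewrite sum_nat_const card_ord; apply/eq_leq; ring.
  rewrite [X in (_ <= X)%N](bigID (fun i : 'I_I => (0 < i)%N)) /=.
  apply: leq_trans (leq_addr _ _); apply: leq_sum => i i0.
  apply: leq_trans (card_short_order _) _.
    by rewrite i0 (ltn_trans _ IleP).
  by rewrite leq_mul2r; apply/orP; right; have := ltn_ord i; lia.
have := leq_trans cSL (subset_leq_card sub).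
move=> /leq_trans/(_ (leq_card_setU _ _)).
move=> /leq_trans/(_ (leq_add (leqnn _) (leq_card_setU _ _))).
move=> /leq_trans/(_ (leq_add (leqnn _) (leq_add (card_nonregular p5) short))) H.
rewrite -mulnDl in H; move: H Ip; move: (7 + _)%N #|_| => c L H Ip.
have : (4 * (c * p ^ 2) <= p ^ 3)%N by rewrite mulnA (expnS p 2) leq_mul2r Ip orbT.
have : (p ^ 3 <= 2 * (p.-1 * p ^ 2))%N.
  by rewrite mulnA (expnS p 2) leq_mul2r; apply/orP; right; lia.
by clear -H; lia.
Qed.

Definition generating_pairs : {set gT * gT} :=
  [set v in setX (SL F) (SL F) | <<[set v.1; v.2]>>%g == SL F].

(** The map [phi] is at most two-to-one: for given [(g, h)] the power [g ^- i] lies in the torus of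
    [g] with [tr (h * g ^- i) = 2], so it has two possible values; it determines [i] because [g] has
    order at least [I], and then [s] and [t]. The factor 32 is 4 for the choice of [g], 4 for
    [(s, t)] and 2 for the fibres. *)
Lemma card_generating_pairs I : (5 < p)%N -> (0 < I)%N ->
  (4 * (7 + 3 * I ^ 2) <= p)%N -> (p ^ 5 * I <= 32 * #|generating_pairs|)%N.
Proof.
move=> p5 I0 Ip.
have two_neq0 : (2 : F) != 0.
  by rewrite -(dvdn_pcharf pF) gtnNdvd // (leq_trans _ p5).
pose phi (u : gT * ('I_I * (F * F))) : gT * gT :=
  (u.1, u.1 ^+ u.2.1 * lowerJ u.2.2.1 u.2.2.2)%g.
pose D : {set gT * ('I_I * (F * F))} := [set u | [&& u.1 \in long_order I,
  u.2.2.2 != 0 & eb (u.1 ^ upper u.2.2.1)%g != 0]].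
have cD : (#|long_order I| * (I * ((p - 2) * p.-1)) <= #|D|)%N.
  rewrite -[#|D|]sum1_card (partition_big fst (mem (long_order I))) /=; last first.
    by move=> u; rewrite inE => /andP[].
  rewrite -sum_nat_const; apply: leq_sum => g gL.
  have /setIdP[gS /andP[rg _]] := gL.
  pose good := ~: [set s : F | eb (g ^ upper s)%g == 0%R].
  have cgood : (p - 2 <= #|good|)%N.
    by rewrite -cF -(cardsC [set s : F | eb (g ^ upper s)%g == 0%R]) leq_subLR
      leq_add2r card_fixed_shear.
  apply: (@leq_trans #|setX [set: 'I_I] (setX good [set~ (0 : F)])|).
    by rewrite !cardsX cardsT card_ord cardsC1 cF leq_mul2l leq_mul2r cgood !orbT.
  rewrite sum1dep_card.
  have inj : injective (fun v : 'I_I * (F * F) => (g, v)) by move=> ? ? [].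
  rewrite -(card_imset _ inj); apply/subset_leq_card/subsetP.
  move=> _ /imsetP[[i [s t]] /setXP[_ /setXP[/= sg tg]] ->].
  rewrite !inE in sg tg; rewrite inE /= eqxx andbT inE /=.
  by apply/and3P; split.
have cphi : (#|D| <= 2 * #|phi @: D|)%N.
  apply: card_le_fiber => -[g0 v0] u0D; set E := [set _ in _ | _].
  set h := (phi (g0, v0)).2.
  have EP u : u \in E -> [/\ u.1 = g0, (u.1 ^+ u.2.1 * lowerJ u.2.2.1 u.2.2.2 = h)%g
      & u.2.2.2 != 0].
    move=> /setIdP[+ /eqP e]; rewrite inE => /and3P[_ t0 _].
    by split=> //; [apply: (congr1 fst e)|apply: (congr1 snd e)].
  have := u0D; rewrite inE /= => /and3P[/setIdP[gS /andP[rg /forallP ord_g]] _ _].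
  have inj : {in E &, injective (fun u : gT * ('I_I * (F * F)) => (g0 ^+ u.2.1)^-1%g)}.
    move=> [g1 [i1 [s1 t1]]] [g2 [i2 [s2 t2]]] /EP/=[-> e1 n1] /EP/=[-> e2 n2].
    move=> /invg_inj ei; congr (_, _).
    have ii : i1 = i2.
      have key (i j : 'I_I) : (i < j)%N -> (g0 ^+ i = g0 ^+ j)%g -> False.
        move=> ij e; have lt : (j - i < I)%N by apply: leq_ltn_trans (leq_subr _ _) _.
        have := ord_g (Ordinal lt); rewrite /= subn_gt0 ij /= => /negP; apply.
        by apply/eqP/(mulgI (g0 ^+ i)%g); rewrite -expgD subnKC ?(ltnW ij) // mulg1 e.
      apply/val_inj/eqP; case: ltngtP => // lt.
        by case: (key _ _ lt ei).
      by case: (key _ _ lt (esym ei)).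
    congr (_, _) => //; apply: lowerJ_inj => //.
    by apply: (mulgI (g0 ^+ i1)%g); rewrite e1 ei e2.
  rewrite -(card_in_imset inj).
  apply: (@card_cent_tr_neq0 F g0 h 2) => // _ /imsetP[u uE ->].
  have [e1 e2 _] := EP u uE; split.
  - by rewrite groupV groupX.
  - by apply/commuteV/commuteX.
  - by rewrite trM_comm -e2 e1 mulKg tr_lowerJ.
have sub : phi @: D \subset generating_pairs.
  apply/subsetP => _ /imsetP[u + ->]; rewrite inE => /and3P[/setIdP[gS _] t0 b0].
  apply/setIdP; split; last by rewrite /= lowerJ_generates.
  by apply/setXP; split=> //=; rewrite groupM ?groupX ?lowerJ_SL.
have H1 := card_long_order p5 I0 Ip.
have H2 : (p ^ 2 <= 4 * ((p - 2) * p.-1))%N by rewrite -mulnn; clear -p5; nia.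
have H3 := leq_trans cD (leq_trans cphi (leq_mul (leqnn 2) (subset_leq_card sub))).
apply: leq_trans (_ : 16 * (2 * #|generating_pairs|) <= _)%N; last by rewrite mulnA.
apply: leq_trans (leq_mul (leqnn 16) H3).
apply: (@leq_trans (4 * #|long_order I| * (I * (4 * ((p - 2) * p.-1))))%N).
  rewrite (expnD p 3 2) -mulnA leq_mul // mulnC leq_mul2l; apply/orP; right.
  exact: H2.
by apply/eq_leq; ring.
Qed.

End Generation.

(** * The diameter bound *)

Lemma slow_growth_step (f : nat -> nat) K J : 0 < f 0 -> f J < K ^ J ->
  exists2 j, j < J & f j.+1 <= K * f j.
Proof.
move=> f0 fJ; have [/existsP[j Hj]|/existsPn H] :=
  boolP [exists j : 'I_J, f j.+1 <= K * f j]; first by exists j.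
suff big j : j <= J -> K ^ j <= f j by move: fJ; rewrite ltnNge big.
elim: j => [|j IHj] jJ; first by rewrite expn0.
have := H (Ordinal jJ); rewrite -ltnNge /= => /ltnW; apply: leq_trans.
by rewrite expnS leq_mul2l IHj ?orbT // ltnW.
Qed.

(* The scale is K = 2 ^ k, so that p lies between K ^ 88 and (2K) ^ 88. Words of length
   11k give at least K ^ 11 elements, as [growth_dichotomy] requires, and
   p ^ 3 < K ^ 528 bounds the number of scales that can expand by a factor K. *)
Section Diameter.
Variables (F : finFieldType) (p k : nat).
Hypotheses (pF : p \in [pchar F]%R) (cF : #|F| = p).
Hypotheses (k7 : 7 <= k) (p_ge : 2 ^ (88 * k) <= p) (p_lt : p < 2 ^ (88 * k.+1)).
Local Notation gT := (gl2 F).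

Let p_gt m : m < 616 -> 2 ^ m < p.
Proof.
move=> m_lt; apply: leq_trans p_ge; rewrite ltn_exp2l //.
by apply: (leq_trans m_lt); rewrite -[616]/(88 * 7) leq_mul2l.
Qed.

Lemma SL_sub_ball J (g h : gT) : 528 <= J -> (g, h) \in generating_pairs F ->
  (g, h) \notin bad_pairs F (11 * k) ->
  SL F \subset word_ball [set g; h] (64 * 6 ^ J * (11 * k)).
Proof.
move=> J_ge /setIdP[/setXP[/= gS hS] /eqP gen].
move=> /(good_pair_ball gS hS)[c0 big]; set S := [set g; h] in gen big *.
set n := 11 * k in big *; pose K := 2 ^ k.
have K128 : 128 <= K by rewrite -[128]/(2 ^ 7) leq_exp2l.
have n0 : 0 < n by rewrite /n muln_gt0 (leq_trans _ k7).
have SS : S \subset SL F by rewrite -gen subset_gen.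
have ballS r : word_ball S r \subset SL F by apply: (@ball_sub _ S (SL_group F)).
have pK : K ^ 88 <= p by rewrite -expnM mulnC.
pose f j := #|word_ball S (6 ^ j * n)|.
have f0 : K ^ 11 <= f 0 by rewrite /f expn0 mul1n -expnM mulnC.
have f_mono j : f 0 <= f j.
  by apply/subset_leq_card/sub_ball; rewrite leq_mul2r leq_exp2l ?orbT.
have [||j jJ step] := @slow_growth_step f K J _ _.
- by apply: leq_trans f0; rewrite expn_gt0 expn_gt0.
- apply: (@leq_ltn_trans (p ^ 3)).
    by apply: leq_trans (subset_leq_card (ballS _)) _; rewrite -cF card_SL_le.
  apply: (@leq_trans (K ^ 528)); last by rewrite leq_pexp2l // expn_gt0.
  (* [3 * 88 * (k + 1) <= 528 * k] for positive [k]. *)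
  rewrite -expnM (leq_trans (n := (2 ^ (88 * k.+1)) ^ 3)) ?ltn_exp2r //.
  by rewrite -expnM leq_exp2l //; clear -k7; lia.
set r := 6 ^ j * n; have r0 : 0 < r by rewrite muln_gt0 expn_gt0.
have two_neq0 : (2 : F)%R != 0%R.
  by rewrite -(dvdn_pcharf pF) gtnNdvd // (p_gt (isT : 1 < 616)).
have gSS : g \in S by rewrite !inE eqxx.
have hSS : h \in S by rewrite !inE eqxx orbT.
have := @growth_dichotomy F two_neq0 S g h r gen gSS hSS c0 r0 K K128.
rewrite mul1n cF => H.
have {}H : p ^ 6 <= K ^ 12 * #|word_ball S r| ^ 2.
  apply: H; last exact: leq_trans (f_mono j).
  by rewrite mulnA -expnS.
(* Size [p ^ 3 / K ^ 6] is enough once [p ^ 2 > 16 * K ^ 36], which [p >= K ^ 88] amply gives. *)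
have big3 : 4 * p ^ 8 < #|word_ball S r| ^ 3.
  rewrite ltnNge; apply/negP => le.
  have : p ^ 18 <= 16 * K ^ 36 * p ^ 16.
    apply: (@leq_trans ((K ^ 12 * #|word_ball S r| ^ 2) ^ 3)).
      by rewrite (expnM p 6 3) leq_exp2r.
    apply: (@leq_trans (K ^ 36 * (#|word_ball S r| ^ 3) ^ 2)); first by apply/eq_leq; ring.
    apply: (@leq_trans (K ^ 36 * (4 * p ^ 8) ^ 2)); last by apply/eq_leq; ring.
    by rewrite leq_mul2l leq_exp2r // le orbT.
  have p0 : 0 < p by apply: leq_trans (p_gt (isT : 0 < 616)).
  rewrite (expnD p 2 16) leq_pmul2r ?expn_gt0 ?p0 //; apply/negP; rewrite -ltnNge.
  have K1 : 1 < K by apply: leq_trans K128.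
  apply: (@leq_ltn_trans (K ^ 37)).
    by rewrite (expnS K 36) leq_mul2r (leq_trans _ K128) ?orbT.
  apply: (@leq_trans (K ^ 88)); first by rewrite ltn_exp2l.
  by apply: leq_trans pK _; rewrite -{1}(expn1 p) leq_pexp2l.
have cov : SL F \subset (word_ball S r ^+ 64)%g.
  by apply: SL_covered => //; [move=> x; apply: ballV|rewrite cF].
apply: subset_trans cov _; rewrite /word_ball -expgM; apply: sub_ball.
rewrite mulnC -mulnA leq_mul2l /= /r leq_mul2r; apply/orP; right.
by rewrite leq_exp2l // ltnW.
Qed.

Lemma card_bad_generating :
  #|bad_pairs F (11 * k)| * 2 ^ k <= 32 * #|generating_pairs F|.
Proof.
have p5 : 5 < p by apply: leq_trans (p_gt (isT : 3 < 616)).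
have k0 : 0 < k by apply: leq_trans k7.
(* [I = 2 ^ (40 * k)] has square below [p] with a margin [2 ^ (8 * k)], and still dominates the
   [2 ^ (22 * k)] pairs of words. *)
have := @card_generating_pairs F p pF cF (2 ^ (40 * k)) p5.
rewrite expn_gt0 => /(_ isT) H; apply: leq_trans (H _); last first.
  apply: leq_trans p_ge.
  apply: (@leq_trans (4 * (10 * (2 ^ (40 * k)) ^ 2))).
    by rewrite leq_mul2l /= (mulnDl 7 3) leq_add2r leq_pmulr ?expn_gt0.
  rewrite mulnA -expnM (_ : 88 * k = 8 * k + 40 * k * 2); last by lia.
  rewrite expnD leq_mul2r; apply/orP; right.
  by apply: (@leq_trans (2 ^ 6)); rewrite // leq_exp2l //; lia.
have np : 2 ^ (11 * k) < p.
  by apply: leq_trans p_ge; rewrite ltn_exp2l // ltn_mul2r k0.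
have := card_bad_pairs pF np; rewrite cF => Hb.
apply: leq_trans (leq_mul Hb (leqnn _)) _.
rewrite mulnAC mulnC leq_mul2l; apply/orP; right.
(* One factor [2 ^ k] and the constant [2 ^ 7] absorb the degrees; [24 * k + 7 <= 40 * k] leaves
   room for the saving [2 ^ k]. *)
apply: (@leq_trans (2 ^ (23 * k + 7) * 2 ^ k)); last first.
  by rewrite -expnD leq_exp2l //; lia.
rewrite leq_mul2r; apply/orP; right.
have e22 : 4 ^ (11 * k) = 2 ^ (22 * k) by rewrite -[4]/(2 ^ 2) -expnM mulnA.
have k_le : k <= 2 ^ k by apply/ltnW/ltn_expl.
rewrite e22 (_ : 23 * k + 7 = 22 * k + (k + 7)); last by lia.
rewrite expnD (expnD 2 k 7).
apply: (@leq_trans (2 ^ (22 * k) * (6 * (11 * k) + 2) + 2 ^ (22 * k) * 1)).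
  by rewrite leq_add2l muln1; apply: (@leq_trans (2 ^ 4)); rewrite // leq_exp2l //; lia.
rewrite -mulnDr leq_mul2l; apply/orP; right.
by apply: (@leq_trans (2 ^ k * 69)); [lia|rewrite leq_mul2l; apply/orP; right].
Qed.

End Diameter.

(* Loaded only here: these libraries redefine names such as subsetP. *)
From mathcomp Require Import all_classical all_reals all_analysis.
Import numFieldNormedType.Exports.

(** * Transfer to the pairs and the diameter of the statement *)

Section Bridge.
(* Unsealed, [gl2 'F_p] is convertible to the group [{'GL_2(p)}] of the statement. *)
Local Transparent gl2.
Variable p : nat.

Lemma card_gen_pairs : #|gen_pairs p| = #|generating_pairs 'F_p|.
Proof.
apply: eq_card => -[g h]; apply/idP/idP.
  by rewrite inE => /and3P[gS hS gen]; apply/setIdP; split; [apply/setXP|].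
by move=> /setIdP[/setXP[gS hS] gen]; rewrite inE; apply/and3P.
Qed.

Lemma card_large_diam_pairs (R : realType) (C : R) n l :
  ((l%:R : R) <= C * ln (p%:R : R))%R ->
  (forall g h : gl2 'F_p, (g, h) \in generating_pairs 'F_p ->
     (g, h) \notin bad_pairs 'F_p n -> SL 'F_p \subset word_ball [set g; h] l) ->
  #|large_diam_pairs C p| <= #|bad_pairs 'F_p n|.
Proof.
move=> lC cover; apply: subset_leq_card; apply/fintype.subsetP => -[g h].
rewrite inE => /andP[gen large]; apply: contraLR large => good; rewrite -leNgt.
have genS : <<[set g; h]>>%g = SL2 p :> {set {'GL_2(p)}}.
  by move: gen; rewrite inE => /and3P[_ _ /eqP].
apply: le_trans lC; rewrite ler_nat; have [_] := cayley_diamP genS; apply.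
move=> x xS; apply: (@ball_word (gl2 'F_p)).
have gen' : (g, h) \in generating_pairs 'F_p.
  move: gen; rewrite inE => /and3P[gS hS gen].
  by apply/setIdP; split; [apply/setXP|].
exact: (fintype.subsetP (cover g h gen' good)).
Qed.

End Bridge.

Local Open Scope classical_set_scope.
Local Open Scope ring_scope.

Theorem corollary6p5 (R : realType) :
  exists2 C : R, 0 < C &
    (#|large_diam_pairs C p|%:R / #|gen_pairs p|%:R : R)
      @[p --> within [set p : nat | prime p] \oo] --> (0 : R).
Proof.
(* [J] is kept abstract so that [6 ^ J] stays symbolic. *)
have [J J_ge] : exists J, (528 <= J)%N by exists 528%N.
have ln2_gt0 : 0 < ln (2 : R) by rewrite ln_gt0 // ltr1n.
exists ((64 * 6 ^ J)%:R / ln 2).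
  by rewrite divr_gt0 // ltr0n muln_gt0 expn_gt0.
apply/cvgrPdist_le => e e0; rewrite near_withinE.
(* The exceptional proportion is at most [32 / 2 ^ k]; with [2 ^ k >= k >= k0 >= 32 / e] it is at
   most [e]. *)
pose k0 := maxn 7 (Num.truncn (32 / e)).+1.
exists (2 ^ (88 * k0))%N => // p /= p_large p_pr.
have pF : p \in [pchar 'F_p] by rewrite pchar_Fp.
have cF : #|'F_p| = p by rewrite card_Fp.
have p0 : (0 < p)%N by apply: prime_gt0.
pose k := (trunc_log 2 p %/ 88)%N.
have p_ge : (2 ^ (88 * k) <= p)%N.
  apply: leq_trans (trunc_logP (isT : 1 < 2)%N p0).
  by rewrite leq_exp2l // mulnC leq_trunc_div.
have p_lt : (p < 2 ^ (88 * k.+1))%N.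
  apply: leq_trans (trunc_log_ltn p (isT : 1 < 2)%N) _.
  by rewrite leq_exp2l // mulnC ltn_ceil.
have k0k : (k0 <= k)%N.
  rewrite -ltnS -(ltn_pmul2l (isT : 0 < 88)%N) -(ltn_exp2l _ _ (isT : 1 < 2)%N).
  exact: leq_ltn_trans p_lt.
have k7 : (7 <= k)%N by apply: leq_trans k0k; rewrite leq_max.
rewrite sub0r normrN ger0_norm ?divr_ge0 //.
set C : R := _ / ln 2.
have large_le : (#|large_diam_pairs C p| <= #|bad_pairs 'F_p (11 * k)|)%N.
  apply: (@card_large_diam_pairs p R _ _ (64 * 6 ^ J * (11 * k))); last first.
    by move=> g h; apply: (SL_sub_ball pF cF k7 p_ge p_lt J_ge).
  (* The radius is logarithmic because [2 ^ (11 * k) <= p], that is [11 * k <= ln p / ln 2]. *)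
  rewrite natrM -mulrA ler_wpM2l // ler_pdivlMl // mulr_natr -lnXn // -natrX.
  rewrite ler_ln ?posrE ?ltr0n ?expn_gt0 // ler_nat (leq_trans _ p_ge) //.
  by rewrite leq_exp2l // leq_mul2r orbT.
have count := card_bad_generating pF cF k7 p_ge p_lt.
have {}count : (#|large_diam_pairs C p| * k0 <= 32 * #|gen_pairs p|)%N.
  rewrite card_gen_pairs; apply: leq_trans count; apply: leq_mul => //.
  by apply: (leq_trans k0k); apply/ltnW/ltn_expl.
have e32 : 32 <= e * k0%:R.
  rewrite mulrC -ler_pdivrMr //; apply: ltW; apply: lt_le_trans (truncnS_gt _) _.
  by rewrite ler_nat leq_maxr.
(* A vanishing denominator makes the quotient 0 by convention. *)
have [->|gen0] := posnP #|gen_pairs p|; first by rewrite invr0 mulr0 ltW.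
rewrite ler_pdivrMr ?ltr0n //.
have k0_gt0 : 0 < k0%:R :> R by rewrite ltr0n leq_max.
rewrite -(ler_pM2r k0_gt0) mulrAC; apply: (@le_trans _ _ (32 * #|gen_pairs p|%:R)).
  by rewrite -!natrM ler_nat.
by rewrite ler_wpM2r.
Qed.
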